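(* Let $\delta>0$. There exists a constant $c>0$ such that $$|E_k(ix,gy)|\le\frac{c}{\sqrt{w_k(x)\,w_k(y)}}$$ for all $x,y\in C_\delta$ and all $g\in G$.
   Context: Let $R$ be a reduced root system in $\mathbb{R}^n$ spanning $\mathbb{R}^n$, $R^+$ a positive subsystem, $\Delta=\{\alpha_1,\dots,\alpha_n\}$ the corresponding simple roots, and $G\subset O(\mathbb{R}^n)$ the finite reflection group generated by the reflections $\sigma_\alpha$, $\alpha\in R$, where $\sigma_\alpha$ is the orthogonal reflection in the hyperplane orthogonal to $\alpha$. $\langle\cdot,\cdot\rangle$ is the Euclidean inner product (extended bilinearly to $\mathbb{C}^n$) and $|\cdot|$ its norm. The open fundamental Weyl chamber is $C=\{\sum_{i=1}^n x_i\lambda_i:\ x_i>0 \ \forall i\}$ where $(\lambda_i)$ is the dual basis of $\Delta$ ($\langle\lambda_i,\alpha_j\rangle=\delta_{ij}$); equivalently $C=\{x:\langle x,\alpha\rangle>0\ \forall\alpha\in R^+\}$. For $\delta>0$, $$C_\delta=\{x\in C:\ \langle x,\alpha\rangle\ge\delta|x|\ \text{ for all }\alpha\in R^+\}.$$ Let $k:R\to[0,+\infty)$ be a $G$-invariant function (multiplicity function), and $\gamma_k=\sum_{\alpha\in R^+}k(\alpha)$, assumed $>0$. The weight is $w_k(x)=\prod_{\alpha\in R^+}|\langle\alpha,x\rangle|^{2k(\alpha)}$. The Dunkl operators are, for $\xi\in\mathbb{R}^n$, $$D_\xi^kf(x)=\partial_\xi f(x)+\sum_{\alpha\in R^+}k(\alpha)\langle\alpha,\xi\rangle\frac{f(x)-f(\sigma_\alpha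 x)}{\langle\alpha,x\rangle}.$$ For $y\in\mathbb{C}^n$, the Dunkl kernel $x\mapsto E_k(x,y)$ is the unique real-analytic solution on $\mathbb{R}^n$ of $D_\xi^kf=\langle y,\xi\rangle f$ for all $\xi\in\mathbb{R}^n$ with $f(0)=1$; $E_k$ extends to a holomorphic function on $\mathbb{C}^n\times\mathbb{C}^n$. *)

(* Defs.v *)
From HB Require Import structures.
From mathcomp Require Import all_boot all_order all_algebra finmap complex.
From mathcomp Require Import all_classical all_reals all_analysis.

Set Implicit Arguments.
Unset Strict Implicit.
Unset Printing Implicit Defensive.

Import Order.TTheory GRing.Theory Num.Theory numFieldNormedType.Exports.

Local Open Scope classical_set_scope.
Local Open Scope ring_scope.
Local Open Scope complex_scope.

(* For T := R this is the Euclidean inner product, for T := R[i] its bilinear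
   (not sesquilinear) extension to C^n. *)
Definition dotp (T : comNzRingType) (n : nat) (u v : 'rV[T]_n) : T :=
  \sum_j u 0 j * v 0 j.

(* The library norm on 'rV[R]_n is the sup norm. *)
Definition enorm (R : realType) (n : nat) (x : 'rV[R]_n) : R :=
  Num.sqrt (dotp x x).

Section RootSystems.
Variables (R : realType) (n : nat).
Implicit Types (a b x : 'rV[R]_n) (Phi Pos : {fset 'rV[R]_n}).

Definition reflection a x : 'rV[R]_n :=
  x - (2 * dotp x a / dotp a a) *: a.

(* No integrality (crystallographic) condition. *)
Definition reduced_root_system Phi : Prop :=
  [/\ 0 \notin Phi,
      (<<Phi>> = fullv)%VS,
      forall a b, a \in Phi -> b \in Phi -> reflection a b \in Phi
    & forall a (t : R), a \in Phi -> t *: a \in Phi -> t = 1 \/ t = -1].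

Inductive reflection_group Phi : ('rV[R]_n -> 'rV[R]_n) -> Prop :=
| RefGen a of a \in Phi : reflection_group Phi (reflection a)
| RefOne : reflection_group Phi id
| RefMul g h of reflection_group Phi g & reflection_group Phi h :
    reflection_group Phi (g \o h)
| RefInv g h of reflection_group Phi g & cancel g h & cancel h g :
    reflection_group Phi h.

Definition positive_subsystem Phi Pos : Prop :=
  exists2 b, (forall a, a \in Phi -> dotp a b != 0)
    & forall a, (a \in Pos) = (a \in Phi) && (0 < dotp a b).

Definition simple_roots Pos (al : 'I_n -> 'rV[R]_n) : Prop :=
  [/\ forall i, al i \in Pos,
      basis_of fullv (codom al)
    & forall a, a \in Pos ->
        exists2 t : 'I_n -> R, (forall i, 0 <= t i) & a = \sum_i t i *: al i].

Definition dual_basis (al lam : 'I_n -> 'rV[R]_n) : Prop :=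
  forall i j, dotp (lam i) (al j) = (i == j)%:R.

Definition weyl_chamber (lam : 'I_n -> 'rV[R]_n) : set 'rV[R]_n :=
  [set x | exists2 t : 'I_n -> R, (forall i, 0 < t i)
                                & x = \sum_i t i *: lam i].

Definition weyl_subcone Pos (lam : 'I_n -> 'rV[R]_n) (delta : R) :
    set 'rV[R]_n :=
  [set x | weyl_chamber lam x /\
           forall a, a \in Pos -> delta * enorm x <= dotp x a].

(* Only the values of k on Phi matter. *)
Definition multiplicity_function Phi (k : 'rV[R]_n -> R) : Prop :=
  (forall a, a \in Phi -> 0 <= k a) /\
  (forall g a, reflection_group Phi g -> a \in Phi -> k (g a) = k a).

Definition gamma_k Pos (k : 'rV[R]_n -> R) : R := \sum_(a <- Pos) k a.

Definition weight Pos (k : 'rV[R]_n -> R) x : R :=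
  \prod_(a <- Pos) (`|dotp a x| `^ (2 * k a)).

End RootSystems.

Section DunklKernel.
Variables (R : realType) (n : nat).
Implicit Types (a x xi : 'rV[R]_n) (Pos : {fset 'rV[R]_n}).
Implicit Types (k : 'rV[R]_n -> R) (f : 'rV[R]_n -> R[i]).

Definition cvec x : 'rV[R[i]]_n := map_mx (real_complex R) x.

Definition ddir xi f x : R[i] :=
  ('D_xi (fun z => complex.Re (f z)) x) +i*
  ('D_xi (fun z => complex.Im (f z)) x).

(* (f x - f (sigma_a x)) / <a, x>, whose singularity on the hyperplane
   <a, x> = 0 is removable for differentiable f: as
   sigma_a x = x - (2 <a, x> / <a, a>) a, the value there is
   (2 / <a, a>) d_a f x. *)
Definition dunkl_quotient a f x : R[i] :=
  if dotp a x == 0 then (2 / dotp a a)%:C * ddir a f x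
  else (f x - f (reflection a x)) / (dotp a x)%:C.

Definition dunkl_operator Pos k xi f x : R[i] :=
  ddir xi f x + \sum_(a <- Pos) (k a * dotp a xi)%:C * dunkl_quotient a f x.

Definition monomial (m : 'I_n -> nat) x : R := \prod_j x 0 j ^+ m j.

(* Around each point f is the sum of an absolutely convergent power series,
   indexed by multi-indices and summed over the cubes [0, N)^n. *)
Definition real_analytic f : Prop :=
  forall x0, exists2 r : R, 0 < r &
  exists c : {ffun 'I_n -> nat} -> R[i],
  forall x, ball x0 r x ->
    summable setT (fun m : {ffun 'I_n -> nat} =>
      (complex.Re `|c m * (monomial m (x - x0))%:C|)%:E) /\
    (fun N : nat => (\sum_(m : {ffun 'I_n -> 'I_N})
       c [ffun j => m j : nat] * (monomial (fun j => m j) (x - x0))%:C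
       : R[i]^o)) @ \oo --> (f x : R[i]^o).

Definition holomorphic (F : 'rV[R[i]^o]_n * 'rV[R[i]^o]_n -> R[i]^o) : Prop :=
  forall z, differentiable F z.

(* E is the Dunkl kernel E_k on C^n x C^n: these conditions determine E, since
   for each y the eigenvalue problem has exactly one analytic solution, and a
   holomorphic function is determined by its values on R^n x C^n. *)
Definition is_dunkl_kernel Pos k (E : 'rV[R[i]]_n -> 'rV[R[i]]_n -> R[i]) :
    Prop :=
  holomorphic (fun z => E z.1 z.2) /\
  forall y : 'rV[R[i]]_n,
    let f := fun x => E (cvec x) y in
    [/\ real_analytic f,
        f 0 = 1
      & forall xi x, dunkl_operator Pos k xi f x = dotp y (cvec xi) * f x].

End DunklKernel.

(* Main.v *)
Require Import Defs.
From HB Require Import structures.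
From mathcomp Require Import all_boot all_order all_algebra finmap complex.
From mathcomp Require Import all_classical all_reals all_analysis.
From mathcomp Require Import ring lra.
Import Order.TTheory GRing.Theory Num.Theory numFieldNormedType.Exports.
Local Open Scope classical_set_scope.
Local Open Scope ring_scope.
Local Open Scope complex_scope.

Set Implicit Arguments.
Unset Strict Implicit.
Unset Printing Implicit Defensive.

(** Why the bound holds.

    Write K z x p for E (cvec x) (z *: cvec p) with x, p real and z complex, so
    that K 'i x p is the Dunkl kernel at (ix, p).  Taking xi = x in the Dunkl
    equation at the point s x and multiplying by s clears every denominator:
    with a ranging over all roots and half multiplicities w,

      s d/ds K z (s x) p + \sum_a w a (K z (s x) p - K z (s sigma_a x) p)
         = s z <p, x> K z (s x) p.

    The functions obtained by moving x (or p) through a finite family of points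
    stable under the reflections thus solve a finite linear system on a
    half-line, regular singular at 0 (ray_system).  Everything is read off
    from this system.

    - Solutions are determined by their value at 0 (ray_system_unique): the
      matrix of the sum over a is positive semidefinite since w >= 0, so the
      squared norm of a solution grows at most exponentially.  Two solutions
      built from E that share the system therefore agree, which gives
      K z (c x) p = K (c z) x p for real c (kernel_scale) and
      K z (sigma_b x) (sigma_b p) = K z x p (kernel_reflection).

    - The equation describes E only at real first arguments, while the bound is
      about E (ix, p).  The entire function
      c |-> E (c x, p) - E (x, c p) vanishes for real c, hence at c = 'i
      (kernel_imaginary).  This needs the identity theorem for functions that
      are merely complex differentiable (identity_theorem_at_i).  It rests on
      Goursat's theorem on rectangles, phrased with antiderivatives instead of
      path integrals: if U is an x-antiderivative of the real part and V a
      y-antiderivative of the imaginary part, the mixed second difference of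
      U + V over any rectangle is zero (goursat_mixed_diff).  Multiplying the
      function by a high power of a polynomial kernel peaked at 'i then forces
      its value there to be zero.

    - For unit vectors x, y in the subcone, put F_f (t) = K 'i (t x) (f y),
      where f runs over a finite family of linear maps that contains the
      reflection group and is stable under f |-> sigma_a f.  With theta_f = <f y, x> and
      kappa = \sum_a w a = gamma_k, the system reads
      F_f' = i theta_f F_f - (1/t) (kappa F_f - \sum_a w a F_(sigma_a f)).
      The diagonal part gives the decay t^(-kappa).  The coupling terms
      Re (F_f^* F_(sigma_a f)) oscillate at the frequency
      theta_(sigma_a f) - theta_f, which stays away from zero because x and y
      stay away from the walls (frame_phase_gap); subtracting their formal
      primitive, of size O(1/t), from the energy leaves a Lyapunov function V
      with V' <= (- 2 kappa / t + O(1/t^2)) V (lyapunov_derive).  As 1/t^2 is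
      integrable at infinity, t^(2 kappa) V remains bounded
      (ray_system_decay), with constants independent of x and y.  For bounded
      t compactness suffices (kernel_bounded).

    - By kernel_scale, the kernel at (x, y) is the kernel at unit vectors with
      t = |x| |y|; the weights are homogeneous of degree 2 gamma_k and bounded
      on unit vectors, so sqrt (w_k(x) w_k(y)) is at most a constant times
      t^(gamma_k). *)

(** * Real calculus and Goursat's theorem without integrals *)

Section RealCalculus.
Variable R : realType.
Implicit Types f g : R -> R.

Lemma is_derive1D f g (t a b : R) :
  is_derive t 1 f a -> is_derive t 1 g b ->
  is_derive t 1 (fun s => f s + g s) (a + b).
Proof. by move=> fa gb; apply: (is_deriveD (f := f) (g := g)). Qed.

Lemma is_derive1B f g (t a b : R) :
  is_derive t 1 f a -> is_derive t 1 g b ->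
  is_derive t 1 (fun s => f s - g s) (a - b).
Proof. by move=> fa gb; apply: (is_deriveB (f := f) (g := g)). Qed.

Lemma is_derive1M f g (t a b : R) :
  is_derive t 1 f a -> is_derive t 1 g b ->
  is_derive t 1 (fun s => f s * g s) (a * g t + f t * b).
Proof.
move=> fa gb; have := @is_deriveM R R f g t 1 a b fa gb.
by rewrite /GRing.scale /= addrC [g t * a]mulrC.
Qed.

Lemma is_derive1Z f (c t a : R) :
  is_derive t 1 f a -> is_derive t 1 (fun s => c * f s) (c * a).
Proof.
move=> fa; have := is_derive1M (is_derive_cst c t 1) fa.
by rewrite mul0r add0r.
Qed.

Lemma is_derive1_sum (I : finType) (F : I -> R -> R) (t : R) (d : I -> R) :
  (forall i, is_derive t 1 (F i) (d i)) ->
  is_derive t 1 (fun s => \sum_i F i s) (\sum_i d i).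
Proof.
move=> Fd; suff H : forall r : seq I,
    is_derive t 1 (fun s => \sum_(i <- r) F i s) (\sum_(i <- r) d i) by exact: H.
elim=> [|i r IH].
  under eq_fun do rewrite big_nil.
  by rewrite big_nil; exact: is_derive_cst.
under eq_fun do rewrite big_cons.
by rewrite big_cons; exact: is_derive1D.
Qed.

Lemma is_derive1_expR f (t a : R) :
  is_derive t 1 f a -> is_derive t 1 (fun s => expR (f s)) (a * expR (f t)).
Proof.
move=> fa; have := @is_derive1_comp R expR f t _ _ (is_derive_expR (f t)) fa.
by rewrite mulrC.
Qed.

Lemma is_derive1_inv (t : R) : 0 < t ->
  is_derive t 1 (fun s : R => s^-1) (- t ^- 2).
Proof.
move=> t0; have t0' : id t != 0 by exact: lt0r_neq0.
have := @is_deriveV R id t _ 1 t0' (is_derive_id t 1).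
by rewrite /GRing.scale /= mulr1.
Qed.

Lemma is_derive1_continuous f (t a : R) : is_derive t 1 f a ->
  {for t, continuous f}.
Proof.
move=> fa; apply: differentiable_continuous.
by apply/derivable1_diffP.
Qed.

Lemma mean_value_le f (df : R -> R) (c a b : R) : a <= b ->
  (forall x, a <= x <= b -> is_derive x 1 f (df x)) ->
  (forall x, a <= x <= b -> df x <= c) -> f b - f a <= c * (b - a).
Proof.
move=> ab fd dfc.
have [||x xab ->] := @MVT_segment R f df a b ab.
- by move=> x; rewrite in_itv /= => /andP[ax xb]; apply: fd; rewrite !ltW.
- apply: continuous_in_subspaceT => x; rewrite inE /= in_itv /= => xab.
  exact: is_derive1_continuous (fd x xab).
- by rewrite ler_wpM2r ?subr_ge0 // dfc //; move: xab; rewrite in_itv.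
Qed.

Lemma mean_value_ge f (df : R -> R) (c a b : R) : a <= b ->
  (forall x, a <= x <= b -> is_derive x 1 f (df x)) ->
  (forall x, a <= x <= b -> c <= df x) -> c * (b - a) <= f b - f a.
Proof.
move=> ab fd dfc.
have := @mean_value_le (fun s => (-1) * f s) (fun s => (-1) * df s) (- c) a b ab.
move=> /(_ (fun x xab => is_derive1Z _ (fd x xab))) H.
have : (-1) * f b - (-1) * f a <= - c * (b - a).
  by apply: H => x xab; have := dfc x xab; lra.
lra.
Qed.

Lemma mean_value_norm f (df : R -> R) (c e a b : R) : a <= b ->
  (forall x, a <= x <= b -> is_derive x 1 f (df x)) ->
  (forall x, a <= x <= b -> `|df x - c| <= e) ->
  `|f b - f a - c * (b - a)| <= e * (b - a).
Proof.
move=> ab fd dfc.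
have up : f b - f a <= (c + e) * (b - a).
  apply: mean_value_le ab fd _ => x xab; have := dfc x xab.
  rewrite ler_norml => /andP[]; lra.
have lo : (c - e) * (b - a) <= f b - f a.
  apply: mean_value_ge ab fd _ => x xab; have := dfc x xab.
  rewrite ler_norml => /andP[]; lra.
rewrite ler_norml; apply/andP; split; lra.
Qed.

Lemma segment_dist_le (a b x p : R) :
  a <= x <= b -> a <= p <= b -> `|x - p| <= b - a.
Proof. by rewrite ler_norml => /andP[? ?] /andP[? ?]; lra. Qed.

Lemma continuous_antiderivative (M : R) f : continuous f ->
  exists F : R -> R, forall x, - M < x < M -> is_derive x 1 F (f x).
Proof.
move=> cf.
exists (fun x => (\int[lebesgue_measure]_(t in `[- M, x]) f t)%R) => x /andP[Mx xM].
have intf : (@lebesgue_measure R).-integrable `[- M, M] (EFin \o f).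
  apply: continuous_compact_integrable; first exact: segment_compact.
  by apply: continuous_subspaceT.
have [dF F'] := @continuous_FTC1_closed R f (- M) x M xM intf Mx (cf x).
by rewrite derive1E in F'; exact: DeriveDef dF F'.
Qed.

End RealCalculus.

Section Goursat.
Variable R : realType.
Implicit Types (u v U V W : R -> R -> R).

(** First-order expansion of u + iv at p + iq with complex derivative A + iB,
    written with the l1 norm so that no square root enters the estimates. *)
Definition complex_differentiable_at u v (p q : R) := exists A B : R,
  forall e, 0 < e -> exists2 d, 0 < d &
  forall x y, `|x - p| < d -> `|y - q| < d ->
  `|u x y - (u p q + A * (x - p) - B * (y - q))| <= e * (`|x - p| + `|y - q|) /\
  `|v x y - (v p q + B * (x - p) + A * (y - q))| <= e * (`|x - p| + `|y - q|).

(** For W = U + V with dU/dx = u and dV/dy = v this is, up to sign, the integral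
    of the 1-form u dx - v dy around the rectangle. *)
Definition mixed_diff W (x1 x2 y1 y2 : R) :=
  W x2 y2 - W x1 y2 - W x2 y1 + W x1 y1.

Lemma nested_intervals (a b : nat -> R) :
  (forall n, a n <= a n.+1) -> (forall n, b n.+1 <= b n) ->
  (forall n, a n <= b n) -> exists p, forall n, a n <= p <= b n.
Proof.
move=> ai bd ab.
have amono : forall n m, (n <= m)%N -> a n <= a m.
  by move/nondecreasing_seqP: ai => ai n m; exact: ai.
have bmono : forall n m, (n <= m)%N -> b m <= b n.
  by move/nonincreasing_seqP: bd => bd n m; exact: bd.
have abnm n m : a n <= b m.
  apply: le_trans (amono _ _ (leq_maxl n m)) _.
  exact: le_trans (ab _) (bmono _ _ (leq_maxr n m)).
exists (sup (range a)) => n; apply/andP; split.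
  apply: ub_le_sup; last by exists n.
  by exists (b 0%N) => _ [m _ <-].
apply: ge_sup; first by exists (a 0%N), 0%N.
by move=> _ [m _ <-].
Qed.

Lemma half_pow_small (L d : R) : 0 < d -> exists n : nat, L / 2 ^+ n < d.
Proof.
move=> d0; exists (Num.bound `|L / d|).
rewrite ltr_pdivrMr ?exprn_gt0 // mulrC -ltr_pdivrMr //.
apply: le_lt_trans (ler_norm _) _.
apply: lt_trans (archi_boundP (normr_ge0 _)) _.
rewrite -natrX ltr_nat.
exact: ltn_expl.
Qed.

(** An affine u + iv with complex derivative A + iB contributes - B w h from U and
    + B w h from V, where w and h are the side lengths; only the error term of
    the expansion survives. *)
Lemma mixed_diff_small u v U V (p q x1 x2 y1 y2 A B e : R) :
  x1 <= p <= x2 -> y1 <= q <= y2 -> 0 <= e ->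
  (forall x y, x1 <= x <= x2 -> y1 <= y <= y2 ->
     is_derive x 1 (fun s => U s y) (u x y) /\
     is_derive y 1 (fun s => V x s) (v x y)) ->
  (forall x y, x1 <= x <= x2 -> y1 <= y <= y2 ->
  `|u x y - (u p q + A * (x - p) - B * (y - q))| <= e * (`|x - p| + `|y - q|) /\
  `|v x y - (v p q + B * (x - p) + A * (y - q))| <= e * (`|x - p| + `|y - q|)) ->
  `|mixed_diff (fun x y => U x y + V x y) x1 x2 y1 y2| <=
     2 * e * ((x2 - x1) + (y2 - y1)) ^+ 2.
Proof.
move=> /andP[x1p px2] /andP[y1q qy2] e0 dUV appr.
have x12 : x1 <= x2 by exact: le_trans px2.
have y12 : y1 <= y2 by exact: le_trans qy2.
have y11 : y1 <= y1 <= y2 by rewrite lexx.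
have y22 : y1 <= y2 <= y2 by rewrite lexx y12.
have x11 : x1 <= x1 <= x2 by rewrite lexx.
have x22 : x1 <= x2 <= x2 by rewrite lexx x12.
have near_p x : x1 <= x <= x2 -> `|x - p| <= x2 - x1.
  by move=> xx; apply: segment_dist_le; rewrite ?x1p.
have near_q y : y1 <= y <= y2 -> `|y - q| <= y2 - y1.
  by move=> yy; apply: segment_dist_le; rewrite ?y1q.
set w := x2 - x1 in near_p *; set h := y2 - y1 in near_q *.
have w0 : 0 <= w by rewrite subr_ge0.
have h0 : 0 <= h by rewrite subr_ge0.
have bnd x y : x1 <= x <= x2 -> y1 <= y <= y2 ->
    e * (`|x - p| + `|y - q|) <= e * (w + h).
  by move=> xx yy; apply: ler_wpM2l => //; apply: lerD; auto.
have HU : `|(U x2 y2 - U x2 y1) - (U x1 y2 - U x1 y1) - (- B * h) * w|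
    <= (2 * e * (w + h)) * w.
  apply: (@mean_value_norm R (fun x => U x y2 - U x y1)
            (fun x => u x y2 - u x y1)) => // x xx.
    by apply: is_derive1B; [have [] := dUV x y2 xx y22 | have [] := dUV x y1 xx y11].
  have [a2 _] := appr x y2 xx y22; have [a1 _] := appr x y1 xx y11.
  have := le_trans a2 (bnd _ _ xx y22); have := le_trans a1 (bnd _ _ xx y11).
  have Bh : B * h = B * y2 - B * y1 by rewrite /h; ring.
  rewrite !ler_norml => /andP[? ?] /andP[? ?]; apply/andP; split; lra.
have HV : `|(V x2 y2 - V x1 y2) - (V x2 y1 - V x1 y1) - (B * w) * h|
    <= (2 * e * (w + h)) * h.
  apply: (@mean_value_norm R (fun y => V x2 y - V x1 y)
            (fun y => v x2 y - v x1 y)) => // y yy.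
    by apply: is_derive1B; [have [] := dUV x2 y x22 yy | have [] := dUV x1 y x11 yy].
  have [_ a2] := appr x2 y x22 yy; have [_ a1] := appr x1 y x11 yy.
  have := le_trans a2 (bnd _ _ x22 yy); have := le_trans a1 (bnd _ _ x11 yy).
  have Bw : B * w = B * x2 - B * x1 by rewrite /w; ring.
  rewrite !ler_norml => /andP[? ?] /andP[? ?]; apply/andP; split; lra.
have -> : 2 * e * (w + h) ^+ 2 = (2 * e * (w + h)) * w + (2 * e * (w + h)) * h.
  by ring.
have -> : mixed_diff (fun x y => U x y + V x y) x1 x2 y1 y2 =
  ((U x2 y2 - U x2 y1) - (U x1 y2 - U x1 y1) - (- B * h) * w) +
  ((V x2 y2 - V x1 y2) - (V x2 y1 - V x1 y1) - (B * w) * h).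
  by rewrite /mixed_diff; ring.
apply: le_trans (ler_normD _ _) _; exact: lerD.
Qed.

(** The mixed difference is additive over a subdivision while the bound scales
    with the square of the size: one of the four quarters is at least as bad. *)
Lemma mixed_diff_quarter W (eta x1 x2 y1 y2 : R) :
  eta * ((x2 - x1) + (y2 - y1)) ^+ 2 <= `|mixed_diff W x1 x2 y1 y2| ->
  x1 <= x2 -> y1 <= y2 ->
  exists a b c d, [/\ x1 <= a, a <= b, b <= x2 & b - a = (x2 - x1) / 2] /\
     [/\ y1 <= c, c <= d, d <= y2 & d - c = (y2 - y1) / 2] /\
  eta * ((b - a) + (d - c)) ^+ 2 <= `|mixed_diff W a b c d|.
Proof.
move=> big x12 y12; apply: contrapT => no.
pose xm := (x1 + x2) / 2; pose ym := (y1 + y2) / 2.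
pose s := eta * ((x2 - x1) / 2 + (y2 - y1) / 2) ^+ 2.
have small a b c d : [/\ x1 <= a, a <= b, b <= x2 & b - a = (x2 - x1) / 2] ->
     [/\ y1 <= c, c <= d, d <= y2 & d - c = (y2 - y1) / 2] ->
     `|mixed_diff W a b c d| < s.
  move=> ab cd; rewrite ltNge; apply/negP => h; apply: no.
  exists a, b, c, d; split => //; split => //.
  by case: ab => _ _ _ ->; case: cd => _ _ _ ->.
have L : [/\ x1 <= x1, x1 <= xm, xm <= x2 & xm - x1 = (x2 - x1) / 2].
  by rewrite /xm; split; lra.
have Rt : [/\ x1 <= xm, xm <= x2, x2 <= x2 & x2 - xm = (x2 - x1) / 2].
  by rewrite /xm; split; lra.
have D : [/\ y1 <= y1, y1 <= ym, ym <= y2 & ym - y1 = (y2 - y1) / 2].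
  by rewrite /ym; split; lra.
have T : [/\ y1 <= ym, ym <= y2, y2 <= y2 & y2 - ym = (y2 - y1) / 2].
  by rewrite /ym; split; lra.
have := small _ _ _ _ L D; have := small _ _ _ _ L T.
have := small _ _ _ _ Rt D; have := small _ _ _ _ Rt T.
move: big; have -> : mixed_diff W x1 x2 y1 y2 =
  (mixed_diff W x1 xm y1 ym + mixed_diff W x1 xm ym y2) +
  (mixed_diff W xm x2 y1 ym + mixed_diff W xm x2 ym y2).
  by rewrite /mixed_diff; ring.
have -> : eta * (x2 - x1 + (y2 - y1)) ^+ 2 = 4 * s by rewrite /s; field.
move=> big; have := le_trans big (ler_normD _ _).
have := ler_normD (mixed_diff W x1 xm y1 ym) (mixed_diff W x1 xm ym y2).
have := ler_normD (mixed_diff W xm x2 y1 ym) (mixed_diff W xm x2 ym y2).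
lra.
Qed.

(** Goursat's bisection: a rectangle with nonzero mixed difference contains a
    nested sequence of rectangles violating mixed_diff_small at their common
    point. *)
Lemma goursat_mixed_diff u v U V (x1 x2 y1 y2 : R) : x1 < x2 -> y1 < y2 ->
  (forall x y, x1 <= x <= x2 -> y1 <= y <= y2 ->
     is_derive x 1 (fun s => U s y) (u x y) /\
     is_derive y 1 (fun s => V x s) (v x y)) ->
  (forall x y, complex_differentiable_at u v x y) ->
  mixed_diff (fun x y => U x y + V x y) x1 x2 y1 y2 = 0.
Proof.
move=> x12 y12 dUV cd; apply/eqP/negPn/negP => W0.
pose W := fun x y => U x y + V x y.
pose l0 := (x2 - x1) + (y2 - y1).
have l00 : 0 < l0 by rewrite addr_gt0 ?subr_gt0.
pose eta := `|mixed_diff W x1 x2 y1 y2| / l0 ^+ 2.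
have eta0 : 0 < eta by rewrite divr_gt0 ?normr_gt0 ?exprn_gt0.
pose bad (Q : R * R * (R * R)) := [/\ Q.1.1 <= Q.1.2, Q.2.1 <= Q.2.2 &
  eta * ((Q.1.2 - Q.1.1) + (Q.2.2 - Q.2.1)) ^+ 2 <=
     `|mixed_diff W Q.1.1 Q.1.2 Q.2.1 Q.2.2| ].
pose quarter (Q Q' : R * R * (R * R)) :=
  [/\ Q.1.1 <= Q'.1.1, Q'.1.2 <= Q.1.2 & Q'.1.2 - Q'.1.1 = (Q.1.2 - Q.1.1) / 2] /\
  [/\ Q.2.1 <= Q'.2.1, Q'.2.2 <= Q.2.2 & Q'.2.2 - Q'.2.1 = (Q.2.2 - Q.2.1) / 2].
have /choice[f fP] : forall Q, exists Q', bad Q -> bad Q' /\ quarter Q Q'.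
  move=> Q; case: (pselect (bad Q)) => [bQ|nb]; last by exists Q.
  have [xx yy big] := bQ.
  have [a [b [c [d [[? ? ? ab] [[? ? ? cde] big']]]]]] := mixed_diff_quarter big xx yy.
  by exists ((a, b), (c, d)).
pose Q n := iter n f ((x1, x2), (y1, y2)).
have bQ n : bad (Q n).
  elim: n => [|n /fP[]//]; split => /=; [exact: ltW | exact: ltW |].
  rewrite -/l0 -/W /eta divfK ?lexx //.
  by rewrite expf_neq0 // gt_eqF.
have qQ n : quarter (Q n) (Q n.+1) by have [] := fP _ (bQ n).
have [p pQ] : exists p, forall n, (Q n).1.1 <= p <= (Q n).1.2.
  apply: nested_intervals => n.
  - by case: (qQ n) => [[]].
  - by case: (qQ n) => [[]].
  - by case: (bQ n).
have [q qQQ] : exists q, forall n, (Q n).2.1 <= q <= (Q n).2.2.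
  apply: nested_intervals => n.
  - by case: (qQ n) => [_ []].
  - by case: (qQ n) => [_ []].
  - by case: (bQ n).
have lx n : (Q n).1.2 - (Q n).1.1 = (x2 - x1) / 2 ^+ n.
  elim: n => [|n IH]; first by rewrite expr0 divr1.
  by case: (qQ n) => [[_ _ ->] _]; rewrite IH exprS invfM mulrA mulrAC.
have ly n : (Q n).2.2 - (Q n).2.1 = (y2 - y1) / 2 ^+ n.
  elim: n => [|n IH]; first by rewrite expr0 divr1.
  by case: (qQ n) => [_ [_ _ ->]]; rewrite IH exprS invfM mulrA mulrAC.
have inx n : x1 <= (Q n).1.1 /\ (Q n).1.2 <= x2.
  elim: n => [|n [h1 h2]] //; case: (qQ n) => [[h3 h4 _] _].
  by split; [exact: le_trans h3 | exact: le_trans h2].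
have iny n : y1 <= (Q n).2.1 /\ (Q n).2.2 <= y2.
  elim: n => [|n [h1 h2]] //; case: (qQ n) => [_ [h3 h4 _]].
  by split; [exact: le_trans h3 | exact: le_trans h2].
(* With eta / 4 the local estimate gives half of the lower bound eta. *)
have [A [B]] := cd p q; have e0 : 0 < eta / 4 by rewrite divr_gt0.
move=> /(_ _ e0)[d d0 appr].
have [n ln] := half_pow_small l0 d0.
have [xx yy big] := bQ n.
have lxy : (Q n).1.2 - (Q n).1.1 + ((Q n).2.2 - (Q n).2.1) = l0 / 2 ^+ n.
  by rewrite lx ly -mulrDl.
have small : `|mixed_diff W (Q n).1.1 (Q n).1.2 (Q n).2.1 (Q n).2.2| <=
    2 * (eta / 4) * (((Q n).1.2 - (Q n).1.1) + ((Q n).2.2 - (Q n).2.1)) ^+ 2.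
  have [ix1 ix2] := inx n; have [iy1 iy2] := iny n.
  have pn := pQ n; have qn := qQQ n.
  apply: (@mixed_diff_small u v U V p q _ _ _ _ A B) => //.
  - exact: ltW.
  - move=> x y /andP[x1x xx2] /andP[y1y yy2]; apply: dUV.
      by rewrite (le_trans ix1 x1x) (le_trans xx2 ix2).
    by rewrite (le_trans iy1 y1y) (le_trans yy2 iy2).
  - move=> x y xQ yQ; apply: appr.
      apply: le_lt_trans (segment_dist_le xQ pn) (le_lt_trans _ ln).
      by rewrite -lxy lerDl subr_ge0.
    apply: le_lt_trans (segment_dist_le yQ qn) (le_lt_trans _ ln).
    by rewrite -lxy lerDr subr_ge0.
move: (le_trans big small); rewrite lxy.
have : 0 < (l0 / 2 ^+ n) ^+ 2 by rewrite exprn_gt0 // divr_gt0 // exprn_gt0.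
nra.
Qed.

End Goursat.

(** * Complex modulus and complex differentiability *)

Section ComplexModulus.
Variable R : realType.
Implicit Types z w : R[i].
Local Notation normc := (@Normc.normc R).

Lemma normrC z : `|z| = (normc z)%:C.
Proof. by rewrite normc_def; case: z. Qed.

Lemma normc_ge0 z : 0 <= normc z.
Proof. by case: z => a b; exact: sqrtr_ge0. Qed.

Lemma sqr_normcE z : normc z ^+ 2 = complex.Re z ^+ 2 + complex.Im z ^+ 2.
Proof. by case: z => a b; rewrite sqr_sqrtr //= addr_ge0 ?sqr_ge0. Qed.

Lemma norm_Re_le z : `|complex.Re z| <= normc z.
Proof.
rewrite -(ler_pXn2r (n := 2)) ?nnegrE ?normc_ge0 //.
by rewrite sqr_normcE real_normK ?num_real // lerDl sqr_ge0.
Qed.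

Lemma norm_Im_le z : `|complex.Im z| <= normc z.
Proof.
rewrite -(ler_pXn2r (n := 2)) ?nnegrE ?normc_ge0 //.
by rewrite sqr_normcE real_normK ?num_real // lerDr sqr_ge0.
Qed.

Lemma normc_le_ReIm z : normc z <= `|complex.Re z| + `|complex.Im z|.
Proof.
rewrite -(ler_pXn2r (n := 2)) ?nnegrE ?normc_ge0 ?addr_ge0 //.
rewrite sqr_normcE sqrrD !real_normK ?num_real //.
by rewrite addrAC lerDl mulrn_wge0 // mulr_ge0.
Qed.

Lemma ReD z w : complex.Re (z + w) = complex.Re z + complex.Re w.
Proof. by case: z; case: w. Qed.
Lemma ImD z w : complex.Im (z + w) = complex.Im z + complex.Im w.
Proof. by case: z; case: w. Qed.
Lemma ReB z w : complex.Re (z - w) = complex.Re z - complex.Re w.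
Proof. by case: z; case: w. Qed.
Lemma ImB z w : complex.Im (z - w) = complex.Im z - complex.Im w.
Proof. by case: z; case: w. Qed.
Lemma ReM z w : complex.Re (z * w) =
  complex.Re z * complex.Re w - complex.Im z * complex.Im w.
Proof. by case: z; case: w. Qed.
Lemma ImM z w : complex.Im (z * w) =
  complex.Re z * complex.Im w + complex.Im z * complex.Re w.
Proof. by case: z => a b; case: w. Qed.

Lemma pos_complex_real z : 0 < z -> exists2 d : R, 0 < d & d%:C = z.
Proof.
case: z => a b; rewrite ltcE /= => /andP[/eqP b0 a0].
by exists a => //; rewrite b0.
Qed.

Lemma normcX z n : normc (z ^+ n) = normc z ^+ n.
Proof.
elim: n => [|n IH]; first by rewrite !expr0 Normc.normc1.
by rewrite !exprS Normc.normcM IH.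
Qed.

Lemma normc_real (r : R) : normc r%:C = `|r|.
Proof. by rewrite /= expr0n addr0 sqrtr_sqr. Qed.

End ComplexModulus.

Section ComplexDerivative.
Variable R : realType.
Local Notation normc := (@Normc.normc R).

(** The norm of R[i] takes its values in R[i]; this restates derivability with
    real tolerances and the real-valued modulus. *)
Lemma derivable_normc_approx (f : R[i]^o -> R[i]^o) (z : R[i]) :
  derivable f z 1 -> exists D : R[i], forall e : R, 0 < e ->
  exists2 d : R, 0 < d & forall h : R[i], normc h < d ->
    normc (f (z + h) - f z - D * h) <= e * normc h.
Proof.
move=> /cvg_ex[/= D fD]; exists D => e e0.
have e0C : (0 : R[i]) < e%:C by rewrite ltcR.
move/cvgrPdist_le : fD => /(_ _ e0C).
rewrite near_withinE => /nbhs_ballP[/= d d0 dP].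
have [r r0 rd] := pos_complex_real d0.
exists r => // h hr; have [->|h0] := eqVneq h 0.
  by rewrite addr0 subrr sub0r mulr0 oppr0 Normc.normc0 mulr0.
have := dP h; rewrite /ball /= sub0r normrN normrC -rd ltcR => /(_ hr h0).
rewrite /GRing.scale /= mulr1 [h + z]addrC => H.
have {}H : `|D * h - (f (z + h) - f z)| <= e%:C * `|h|.
  rewrite -[f _ - _](mulVKf h0) [h * _]mulrC -mulrBl normrM.
  by rewrite ler_wpM2r //; exact: H.
by move: H; rewrite distrC !normrC -rmorphM lecR.
Qed.

Lemma derivable_complex_differentiable (f : R[i]^o -> R[i]^o) (p q : R) :
  derivable f (p +i* q) 1 ->
  complex_differentiable_at (fun x y => complex.Re (f (x +i* y)))
    (fun x y => complex.Im (f (x +i* y))) p q.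
Proof.
move=> /derivable_normc_approx[D DP].
exists (complex.Re D), (complex.Im D) => e e0.
have [d d0 dP] := DP _ e0; exists (d / 2); first by rewrite divr_gt0.
move=> x y xp yq; set h := (x - p) +i* (y - q).
have hle : normc h <= `|x - p| + `|y - q| by exact: normc_le_ReIm.
have hd : normc h < d.
  by apply: le_lt_trans hle _; rewrite [d]splitr ltrD.
have hz : (p +i* q) + h = x +i* y by rewrite /h; simpc; rewrite !subrKC.
have := dP h hd; rewrite hz => H.
have {}H : normc (f (x +i* y) - f (p +i* q) - D * h) <= e * (`|x - p| + `|y - q|).
  by apply: le_trans H _; rewrite ler_wpM2l // ltW.
split.
  apply: le_trans H; apply: le_trans (norm_Re_le _).
  rewrite !ReB ReM /= le_eqVlt; apply/orP; left; apply/eqP; congr `|_|; ring.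
apply: le_trans H; apply: le_trans (norm_Im_le _).
rewrite !ImB ImM /= le_eqVlt; apply/orP; left; apply/eqP; congr `|_|; ring.
Qed.

End ComplexDerivative.

Section Continuity.
Variable R : realType.
Implicit Types (u v : R -> R -> R) (f : R -> R).

Lemma lipschitz_at_continuous f (p K d : R) : 0 < d -> 0 < K ->
  (forall x, `|x - p| < d -> `|f x - f p| <= K * `|x - p|) ->
  {for p, continuous f}.
Proof.
move=> d0 K0 fK; apply/cvgrPdist_lt => e e0; apply/nbhs_ballP.
exists (Num.min d (e / K)) => /=; first by rewrite lt_min d0 divr_gt0.
move=> x; rewrite /ball /= lt_min distrC => /andP[xd xe].
by rewrite distrC; apply: le_lt_trans (fK _ xd) _; rewrite mulrC -ltr_pdivlMr.
Qed.

Lemma complex_differentiable_continuous u v p q :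
  complex_differentiable_at u v p q ->
  [/\ {for p, continuous (fun x => u x q)}, {for q, continuous (u p)},
      {for p, continuous (fun x => v x q)} & {for q, continuous (v p)}].
Proof.
move=> [A [B /(_ 1 ltr01)[d d0 appr]]].
have AK : 0 < `|A| + `|B| + 1 by rewrite ltr_wpDl // addr_ge0.
have est (a b c : R) : `|a - b| <= 1 * `|c| ->
    (`|b| <= (`|A| + `|B|) * `|c|) -> `|a| <= (`|A| + `|B| + 1) * `|c|.
  move=> h1 h2; rewrite -(subrK b a); apply: le_trans (ler_normD _ _) _.
  by rewrite mulrDl addrC; exact: lerD.
have nA (c : R) : `|A * c| <= (`|A| + `|B|) * `|c|.
  by rewrite normrM ler_wpM2r // lerDl.
have nB (c : R) : `|B * c| <= (`|A| + `|B|) * `|c|.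
  by rewrite normrM ler_wpM2r // lerDr.
have pp : `|p - p| < d by rewrite subrr normr0.
have qq : `|q - q| < d by rewrite subrr normr0.
split; apply: (lipschitz_at_continuous d0 AK) => x xd.
- have [+ _] := appr x q xd qq; rewrite subrr normr0 addr0 => H.
  apply: est (nA _); move: H; congr (`|_| <= _); ring.
- have [+ _] := appr p x pp xd; rewrite subrr normr0 add0r => H.
  apply: est (_ : `|- (B * (x - q))| <= _); last by rewrite normrN.
  by move: H; congr (`|_| <= _); ring.
- have [_] := appr x q xd qq; rewrite subrr normr0 addr0 => H.
  apply: est (nB _); move: H; congr (`|_| <= _); ring.
- have [_] := appr p x pp xd; rewrite subrr normr0 add0r => H.
  apply: est (nA _); move: H; congr (`|_| <= _); ring.
Qed.

Lemma continuous_segment_bounded f (a b : R) : continuous f ->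
  exists2 M : R, 0 < M & forall x, a <= x <= b -> `|f x| <= M.
Proof.
move=> cf.
have : compact (f @` `[a, b]).
  apply: continuous_compact; last exact: segment_compact.
  exact: continuous_subspaceT.
move=> /compact_bounded[M [_ MP]]; exists (`|M| + 1).
  by rewrite ltr_wpDl.
move=> x xab; apply: (MP (`|M| + 1)).
  by rewrite (le_lt_trans (ler_norm _)) // ltrDl.
by exists x => //=; rewrite in_itv.
Qed.

(** Bernoulli: (a / b) ^ N outgrows every constant. *)
Lemma geometric_gap (a b c C : R) : 0 < b -> b < a -> 0 < c ->
  exists N : nat, C * b ^+ N < c * a ^+ N.
Proof.
move=> b0 ba c0; set x := a / b - 1.
have x0 : 0 < x by rewrite subr_gt0 ltr_pdivlMr // mul1r.
have bern n : 1 + n%:R * x <= (1 + x) ^+ n.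
  elim: n => [|n IH]; first by rewrite mul0r addr0 expr0.
  rewrite exprS -natr1; apply: le_trans (_ : (1 + x) * (1 + n%:R * x) <= _).
    have : 0 <= n%:R * x * x by rewrite !mulr_ge0 // ltW.
    nra.
  by rewrite ler_wpM2l // addr_ge0 // ltW.
pose n := Num.bound `|C / c / x|; exists n.
have nx : C / c < n%:R * x.
  rewrite -ltr_pdivrMr //; apply: le_lt_trans (ler_norm _) _.
  exact: archi_boundP.
have -> : a = (1 + x) * b by rewrite /x; field; exact: lt0r_neq0.
rewrite exprMn mulrA ltr_pM2r ?exprn_gt0 // mulrC -ltr_pdivrMr //.
by apply: lt_le_trans nx _; apply: le_trans (bern n); rewrite lerDr.
Qed.

End Continuity.

(** * Entire functions vanishing on the real line *)

Section IdentityTheorem.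
Variable R : realType.
Local Notation normc := (@Normc.normc R).

(** A polynomial substitute for the Gaussian exp (- (z - i)^2): on the top
    side of the rectangle [-10, 10] x [0, 1] its powers concentrate at 'i, and
    on the vertical sides its modulus is at most 6/10. *)
Definition landau_kernel (z : R[i]) : R[i] := 1 - (200^-1)%:C * (z - 'i) ^+ 2.

Lemma derivable_landau_kernel (h : R[i]^o -> R[i]^o) (c : R[i]) N z :
  derivable h z 1 ->
  derivable (fun z : R[i]^o => c * h z * landau_kernel z ^+ N : R[i]^o) z 1.
Proof.
move=> dh.
have di : derivable ((id : R[i]^o -> R[i]^o) - cst 'i) z 1.
  by apply: derivableB; [exact: derivable_id | exact: derivable_cst].
have dk : derivable ((cst 1 : R[i]^o -> R[i]^o) -
    cst (200^-1)%:C * ((id : R[i]^o -> R[i]^o) - cst 'i) ^+ 2) z 1.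
  apply: derivableB; first exact: derivable_cst.
  by apply: derivableM; [exact: derivable_cst | exact: derivableX].
have dc : derivable (cst c : R[i]^o -> R[i]^o) z 1 by exact: derivable_cst.
have := derivableM (derivableM dc dh) (@derivableX _ _ _ N _ _ dk).
by congr (derivable _ z 1); apply/funext => w; rewrite !fctE.
Qed.

Lemma landau_kernel_top (x : R) : landau_kernel (x +i* 1) = (1 - x ^+ 2 / 200)%:C.
Proof.
apply/eqP; rewrite eq_complex /landau_kernel expr2.
rewrite !(ReB, ImB, ReM, ImM) /=.
by apply/andP; split; apply/eqP; ring.
Qed.

Lemma normc_landau_kernel_side (x y : R) : x ^+ 2 = 100 -> 0 <= y <= 1 ->
  normc (landau_kernel (x +i* y)) <= 6 / 10.
Proof.
move=> x2 /andP[y0 y1].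
rewrite -(ler_pXn2r (n := 2)) ?nnegrE ?normc_ge0 //.
rewrite sqr_normcE /landau_kernel expr2 !(ReB, ImB, ReM, ImM) /=.

have y2 : 0 <= (y - 1) ^+ 2 <= 1.
  apply/andP; split; first exact: sqr_ge0.
  by rewrite -sqrrN opprB expr_le1 //; lra.
set s := (y - 1) ^+ 2 in y2.
rewrite [X in X <= _](_ : _ = (1 - (x ^+ 2 - s) / 200) ^+ 2 + x ^+ 2 * s / 10000).
  by rewrite x2; case/andP: y2 => ? ?; nra.
by rewrite /s; field.
Qed.

(** Concentration at 0 on the top side: the part within eta / 2 wins, the parts
    between eta / 2 and eta are nonnegative, and the rest is exponentially
    smaller. *)
Lemma landau_top_side (P U : R -> R) (eta M : R) N :
  0 < eta -> eta <= 1 -> 0 <= M ->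
  (forall x, `|x| <= eta -> 1 / 2 <= P x) ->
  (forall x, - 10 <= x <= 10 -> `|P x| <= M) ->
  (forall x : R, - 10 <= x <= 10 ->
     is_derive x 1 U (P x * (1 - x ^+ 2 / 200) ^+ N)) ->
  eta / 2 * (1 - eta ^+ 2 / 800) ^+ N - 20 * (M * (1 - eta ^+ 2 / 200) ^+ N)
    <= U 10 - U (- 10).
Proof.
move=> eta0 eta1 M0 P_near P_le dU; set B := M * _.
have eta20 : 0 < eta ^+ 2 by rewrite exprn_gt0.
have eta21 : eta ^+ 2 <= 1 by rewrite expr_le1 // ltW.
have b0 : 0 <= 1 - eta ^+ 2 / 200 by lra.
have a0 : 0 <= 1 - eta ^+ 2 / 800 by lra.
have B0 : 0 <= B by rewrite mulr_ge0 ?exprn_ge0.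
have far (x : R) : - 10 <= x <= 10 -> eta <= `|x| ->
    - B <= P x * (1 - x ^+ 2 / 200) ^+ N.
  move=> x10 xeta.
  have x2 : eta ^+ 2 <= x ^+ 2.
    by rewrite -[x ^+ 2]real_normK ?num_real // lerXn2r // nnegrE // ltW.
  have x3 : x ^+ 2 <= 100 by move/andP: x10 => [? ?]; nra.
  have k0 : 0 <= 1 - x ^+ 2 / 200 by lra.
  suff : `|P x * (1 - x ^+ 2 / 200) ^+ N| <= B by rewrite ler_norml => /andP[].
  rewrite normrM normrX (ger0_norm k0).
  apply: ler_pM; rewrite ?exprn_ge0 ?P_le //.
  by apply: lerXn2r; rewrite ?nnegrE //; lra.
have near (x : R) : - eta <= x <= eta -> 1 / 2 <= P x.
  by move=> xe; apply: P_near; rewrite ler_norml.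
have nonneg (x : R) : - eta <= x <= eta -> 0 <= P x * (1 - x ^+ 2 / 200) ^+ N.
  move=> xe; have := near x xe; move/andP: xe => [? ?] ?.
  by rewrite mulr_ge0 ?exprn_ge0 //; nra.
(* The top side is cut at -eta, -eta/2, eta/2, eta. *)
have I1 : - B * (- eta - - 10) <= U (- eta) - U (- 10).
  apply: mean_value_ge => [|x /andP[? ?]|x /andP[? ?]]; first lra.
    apply: dU; lra.
  by apply: far; [lra | rewrite ler0_norm; lra].
have I5 : - B * (10 - eta) <= U 10 - U eta.
  apply: mean_value_ge => [|x /andP[? ?]|x /andP[? ?]]; first lra.
    apply: dU; lra.
  by apply: far; [lra | rewrite ger0_norm; lra].
have I2 : 0 * (- (eta / 2) - - eta) <= U (- (eta / 2)) - U (- eta).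
  apply: mean_value_ge => [|x /andP[? ?]|x /andP[? ?]]; first lra.
    apply: dU; lra.
  apply: nonneg; lra.
have I4 : 0 * (eta - eta / 2) <= U eta - U (eta / 2).
  apply: mean_value_ge => [|x /andP[? ?]|x /andP[? ?]]; first lra.
    apply: dU; lra.
  apply: nonneg; lra.
have I3 : (1 / 2 * (1 - eta ^+ 2 / 800) ^+ N) * (eta / 2 - - (eta / 2))
    <= U (eta / 2) - U (- (eta / 2)).
  apply: mean_value_ge => [|x /andP[? ?]|x /andP[? ?]]; first lra.
    apply: dU; lra.
  apply: ler_pM; rewrite ?exprn_ge0 //.
    by apply: near; lra.
  have x2 : x ^+ 2 <= eta ^+ 2 / 4 by nra.
  by apply: lerXn2r; rewrite ?nnegrE //; lra.
have : 0 <= eta * B by rewrite mulr_ge0 // ltW.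
move: (_ ^+ N) I1 I2 I3 I4 I5 => A; lra.
Qed.

(** After normalizing h 'i = 1, apply goursat_mixed_diff on [-10, 10] x [0, 1]
    to h times the N-th power of the Landau kernel.  The bottom side
    contributes nothing and the vertical sides O((6/10)^N), whereas the top
    side contributes at least a multiple of (1 - eta^2/800)^N near 'i and loses
    O((1 - eta^2/200)^N) away from it.  The point 'i stands for any nonreal
    point: an affine change of variable with real coefficients moves it
    anywhere off the real line. *)
Lemma identity_theorem_at_i (h : R[i]^o -> R[i]^o) :
  (forall z, derivable h z 1) -> (forall r : R, h r%:C = 0) -> h 'i = 0.
Proof.
move=> dh h_real; apply/eqP/negPn/negP => hi0.
pose c := (h 'i)^-1.
pose P x y := complex.Re (c * h (x +i* y)).
pose Q x y := complex.Im (c * h (x +i* y)).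
have dch z : derivable (fun z : R[i]^o => c * h z : R[i]^o) z 1.
  have := @derivable_landau_kernel h c 0 z (dh z).
  by congr (derivable _ z 1); apply/funext => w; rewrite expr0 mulr1.
have PQ x y := derivable_complex_differentiable (dch (x +i* y)).
have P01 : P 0 1 = 1 by rewrite /P mulVf.
have cPx y : continuous (fun x => P x y).
  by move=> x; have [] := complex_differentiable_continuous (PQ x y).
have cPy x : continuous (P x).
  by move=> y; have [] := complex_differentiable_continuous (PQ x y).
have cQy x : continuous (Q x).
  by move=> y; have [] := complex_differentiable_continuous (PQ x y).
have [eta [eta0 eta1 Pnear]] : exists eta : R, [/\ 0 < eta, eta <= 1 &
    forall x, `|x| <= eta -> 1 / 2 <= P x 1].
  have /cvgrPdist_le := cPx 1 0; have e0 : (0 : R) < 1 / 2 by [].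
  move=> /(_ _ e0) /nbhs_ballP[d /= d0 dP].
  exists (Num.min 1 (d / 2)); split.
  - by rewrite lt_min ltr01 divr_gt0.
  - by rewrite ge_min lexx.
  - move=> x; rewrite le_min => /andP[_ xd].
    have := dP x; rewrite /ball /= sub0r normrN P01 => H.
    have : `|1 - P x 1| <= 1 / 2 by apply: H; apply: le_lt_trans xd _; lra.
    by rewrite ler_norml => /andP[]; lra.
have [M1 M10 M1P] := continuous_segment_bounded (- 10) 10 (cPx 1).
have [M2 M20 M2P] := continuous_segment_bounded 0 1 (cPy 10).
have [M3 M30 M3P] := continuous_segment_bounded 0 1 (cQy 10).
have [M4 M40 M4P] := continuous_segment_bounded 0 1 (cPy (- 10)).
have [M5 M50 M5P] := continuous_segment_bounded 0 1 (cQy (- 10)).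
(* M bounds c * h on the vertical sides and its real part on the top side;
   a and b are the values of the kernel on the top side at distances
   eta / 2 and eta from 'i. *)
pose M := M1 + M2 + M3 + M4 + M5.
pose a := 1 - eta ^+ 2 / 800; pose b := 1 - eta ^+ 2 / 200.
have eta20 : 0 < eta ^+ 2 by rewrite exprn_gt0.
have eta21 : eta ^+ 2 <= 1 by rewrite expr_le1 // ltW.
have b6 : 6 / 10 <= b by rewrite /b; lra.
have b0 : 0 < b by apply: lt_le_trans b6; lra.
have ba : b < a by rewrite /a /b; lra.
have a0 : 0 < a by exact: lt_trans ba.
have eta20' : 0 < eta / 2 by rewrite divr_gt0.
have [N] := geometric_gap (22 * M) b0 ba eta20'.
pose F (z : R[i]) := c * h z * landau_kernel z ^+ N.
pose u x y := complex.Re (F (x +i* y)).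
pose v x y := complex.Im (F (x +i* y)).
have uv x y : complex_differentiable_at u v x y.
  by apply: derivable_complex_differentiable; exact: derivable_landau_kernel.
have /choice[U UP] : forall y : R, exists Uy : R -> R, forall x : R, - 20 < x < 20 ->
    is_derive x 1 Uy (u x y).
  move=> y; apply: continuous_antiderivative => x.
  by have [cu _ _ _] := complex_differentiable_continuous (uv x y); exact: cu.
have /choice[V VP] : forall x : R, exists Vx : R -> R, forall y : R, - 20 < y < 20 ->
    is_derive y 1 Vx (v x y).
  move=> x; apply: continuous_antiderivative => y.
  by have [_ _ _ cv] := complex_differentiable_continuous (uv x y); exact: cv.
have x12 : (- 10 : R) < 10 by lra.
have := @goursat_mixed_diff R u v (fun x y => U y x) V (- 10) 10 0 1 x12 ltr01 _ uv.
rewrite /mixed_diff => stokes.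
have {}stokes : U 1 10 + V 10 1 - (U 1 (- 10) + V (- 10) 1)
    - (U 0 10 + V 10 0) + (U 0 (- 10) + V (- 10) 0) = 0.
  apply: stokes => x y /andP[? ?] /andP[? ?].
  split; [apply: UP | apply: VP]; lra.
have bottom : U 0 10 = U 0 (- 10).
  have := @mean_value_norm R (U 0) (fun x => u x 0) 0 0 _ _ (ltW x12).
  have H1 (x : R) : - 10 <= x <= 10 -> is_derive x 1 (U 0) (u x 0).
    by move=> /andP[? ?]; apply: UP; lra.
  have H2 (x : R) : - 10 <= x <= 10 -> `|u x 0 - 0| <= 0.
    by rewrite /u /F h_real mulr0 mul0r subrr normr0.
  move=> /(_ H1 H2).
  by rewrite mul0r subr0 normr_le0 subr_eq0 => /eqP.
have side (x0 : R) : x0 ^+ 2 = 100 ->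
    (forall y : R, 0 <= y <= 1 -> normc (c * h (x0 +i* y)) <= M) ->
    `|V x0 1 - V x0 0| <= M * b ^+ N.
  move=> x02 hM; have := @mean_value_norm R (V x0) (v x0) 0 (M * b ^+ N) 0 1 ler01.
  rewrite mul0r !subr0 mulr1; apply.
    by move=> y /andP[? ?]; apply: VP; lra.
  move=> y y01; rewrite subr0; apply: le_trans (norm_Im_le _) _.
  rewrite /F Normc.normcM normcX; apply: ler_pM; rewrite ?normc_ge0 ?exprn_ge0 ?normc_ge0 //.
    exact: hM.
  apply: lerXn2r; rewrite ?nnegrE ?normc_ge0 ?(ltW b0) //.
  by apply: le_trans b6; exact: normc_landau_kernel_side.
have right : `|V 10 1 - V 10 0| <= M * b ^+ N.
  apply: side => [|y y01]; first by ring.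
  apply: le_trans (normc_le_ReIm _) _; have := M2P _ y01; have := M3P _ y01.
  by rewrite /P /Q /M; lra.
have left : `|V (- 10) 1 - V (- 10) 0| <= M * b ^+ N.
  apply: side => [|y y01]; first by ring.
  apply: le_trans (normc_le_ReIm _) _; have := M4P _ y01; have := M5P _ y01.
  by rewrite /P /Q /M; lra.
have utop (x : R) : u x 1 = P x 1 * (1 - x ^+ 2 / 200) ^+ N.
  by rewrite /u /F landau_kernel_top -rmorphXn /= ReM /= mulr0 subr0.
have dU (x : R) : - 10 <= x <= 10 ->
    is_derive x 1 (U 1) (P x 1 * (1 - x ^+ 2 / 200) ^+ N).
  by rewrite -utop => /andP[? ?]; apply: UP; lra.
have M1M : M1 <= M by rewrite /M; lra.
have M0 : 0 <= M by apply: le_trans M1M; exact: ltW.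
have P_le (x : R) : - 10 <= x <= 10 -> `|P x 1| <= M.
  by move=> x10; exact: le_trans (M1P x x10) M1M.
have := landau_top_side eta0 eta1 M0 Pnear P_le dU.
have Mb0 : 0 <= M * b ^+ N by rewrite mulr_ge0 ?exprn_ge0 // ltW.
rewrite -/a -/b; move: stokes left right.
rewrite -[22 * M * _]mulrA bottom !ler_norml; move: (a ^+ N) (M * b ^+ N) Mb0.
move=> A B B0 ? /andP[? ?] /andP[? ?] ? ?.
lra.
Qed.

End IdentityTheorem.

(** * Linear systems along rays *)

Section PlaneVectors.
Variable R : realType.
Implicit Types z w : R[i].

(** The real and imaginary parts of z^* w: they are treated separately since the
    real part enters the energy and the imaginary part its oscillating
    primitive. *)
Definition cdot z w : R := complex.Re z * complex.Re w + complex.Im z * complex.Im w.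
Definition ccross z w : R := complex.Re z * complex.Im w - complex.Im z * complex.Re w.

Lemma cdot_ge0 z : 0 <= cdot z z.
Proof. by rewrite /cdot -!expr2 addr_ge0 ?sqr_ge0. Qed.

Lemma cdotC z w : cdot z w = cdot w z.
Proof. by rewrite /cdot ![complex.Re z * _]mulrC ![complex.Im z * _]mulrC. Qed.

Lemma cdot_eq0 z : cdot z z = 0 -> z = 0.
Proof.
move=> /eqP; rewrite /cdot -!expr2 paddr_eq0 ?sqr_ge0 // !sqrf_eq0.
by case: z => a b /= /andP[/eqP -> /eqP ->].
Qed.

Lemma cdot_le z w : cdot z w <= (cdot z z + cdot w w) / 2.
Proof.
rewrite /cdot; have := sqr_ge0 (complex.Re z - complex.Re w).
have := sqr_ge0 (complex.Im z - complex.Im w); rewrite !expr2; lra.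
Qed.

Lemma norm_ccross_le z w (s : R) : cdot z z <= s -> cdot w w <= s ->
  `|ccross z w| <= s.
Proof.
rewrite /cdot /ccross ler_norml => zs ws.
have := sqr_ge0 (complex.Re z - complex.Im w).
have := sqr_ge0 (complex.Im z + complex.Re w).
have := sqr_ge0 (complex.Re z + complex.Im w).
have := sqr_ge0 (complex.Im z - complex.Re w); rewrite !expr2.
move=> ? ? ? ?; apply/andP; split; lra.
Qed.

Lemma ReZ (r : R) z : complex.Re (r%:C * z) = r * complex.Re z.
Proof. by rewrite ReM /= mul0r subr0. Qed.

Lemma ImZ (r : R) z : complex.Im (r%:C * z) = r * complex.Im z.
Proof. by rewrite ImM /= mul0r addr0. Qed.

Lemma Re_sum (I : finType) (f : I -> R[i]) :
  complex.Re (\sum_i f i) = \sum_i complex.Re (f i).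
Proof. exact: (big_morph (@complex.Re R) (@ReD R) (erefl _)). Qed.

Lemma Im_sum (I : finType) (f : I -> R[i]) :
  complex.Im (\sum_i f i) = \sum_i complex.Im (f i).
Proof. exact: (big_morph (@complex.Im R) (@ImD R) (erefl _)). Qed.

Definition is_cderive (f : R -> R[i]) (t : R) (d : R[i]) :=
  is_derive t 1 (fun s => complex.Re (f s)) (complex.Re d) /\
  is_derive t 1 (fun s => complex.Im (f s)) (complex.Im d).

Lemma is_cderiveB (f g : R -> R[i]) (t : R) (a b : R[i]) :
  is_cderive f t a -> is_cderive g t b ->
  is_cderive (fun s => f s - g s) t (a - b).
Proof.
move=> [fr fi] [gr gi]; split.
  under eq_fun do rewrite ReB; rewrite ReB; exact: is_derive1B.
under eq_fun do rewrite ImB; rewrite ImB; exact: is_derive1B.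
Qed.

Lemma is_derive_cdot (f g : R -> R[i]) (t : R) (a b : R[i]) :
  is_cderive f t a -> is_cderive g t b ->
  is_derive t 1 (fun s => cdot (f s) (g s)) (cdot a (g t) + cdot (f t) b).
Proof.
move=> [fr fi] [gr gi].
have := is_derive1D (is_derive1M fr gr) (is_derive1M fi gi).
by rewrite /cdot addrACA.
Qed.

Lemma is_derive_ccross (f g : R -> R[i]) (t : R) (a b : R[i]) :
  is_cderive f t a -> is_cderive g t b ->
  is_derive t 1 (fun s => ccross (f s) (g s)) (ccross a (g t) + ccross (f t) b).
Proof.
move=> [fr fi] [gr gi].
have := is_derive1B (is_derive1M fr gi) (is_derive1M fi gr).
by rewrite /ccross opprD addrACA.
Qed.

End PlaneVectors.

Section RaySystem.
Variables (R : realType) (I T : finType) (w : I -> R) (tau : I -> T -> T).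
Hypothesis w_ge0 : forall a, 0 <= w a.

(** The equation is kept multiplied by t, so that it also makes sense, and is
    required, at t = 0. *)
Definition ray_system (Y : T -> R[i]) (F : T -> R -> R[i]) :=
  forall p t, exists2 d, is_cderive (F p) t d &
    t%:C * d + \sum_a (w a)%:C * (F p t - F (tau a p) t) = t%:C * Y p * F p t.

Definition energy (F : T -> R -> R[i]) t : R := \sum_p cdot (F p t) (F p t).

Lemma energy_ge0 F t : 0 <= energy F t.
Proof. by apply: sumr_ge0 => p _; exact: cdot_ge0. Qed.

Lemma cdot_le_energy F t p : cdot (F p t) (F p t) <= energy F t.
Proof.
rewrite /energy (bigD1 p) //= lerDl; apply: sumr_ge0 => q _; exact: cdot_ge0.
Qed.

Lemma ray_systemB Y F G : ray_system Y F -> ray_system Y G ->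
  ray_system Y (fun p t => F p t - G p t).
Proof.
move=> sF sG p t; have [d dF eF] := sF p t; have [e dG eG] := sG p t.
exists (d - e); first exact: is_cderiveB.
rewrite mulrBr [RHS]mulrBr -eF -eG opprD addrACA -sumrB; congr (_ + _).
by apply: eq_bigr => a _; rewrite -mulrBr; congr (_ * _); ring.
Qed.

(** The derivative only enters through its real inner products with other
    values of the solution. *)
Lemma ray_system_cdot Y F (t : R) p (d z : R[i]) :
  t%:C * d + \sum_a (w a)%:C * (F p t - F (tau a p) t) = t%:C * Y p * F p t ->
  t * cdot z d = t * cdot z (Y p * F p t) -
     \sum_a w a * (cdot z (F p t) - cdot z (F (tau a p) t)).
Proof.
move=> e; have {}e : t%:C * d = t%:C * (Y p * F p t) -
    \sum_a (w a)%:C * (F p t - F (tau a p) t) by rewrite mulrA -e addrK.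
have := congr1 (fun x => complex.Re x) e; have := congr1 (fun x => complex.Im x) e.
rewrite ReB ImB Re_sum Im_sum !ReZ !ImZ => eI eR.
rewrite /cdot 2!mulrDr ![t * (_ * _)]mulrCA eI eR !mulrBr !mulr_sumr.
have <- : \sum_a complex.Re z * complex.Re ((w a)%:C * (F p t - F (tau a p) t)) +
   \sum_a complex.Im z * complex.Im ((w a)%:C * (F p t - F (tau a p) t)) =
   \sum_a w a * (complex.Re z * complex.Re (F p t) + complex.Im z * complex.Im (F p t) -
     (complex.Re z * complex.Re (F (tau a p) t) + complex.Im z * complex.Im (F (tau a p) t))).
  by rewrite -big_split /=; apply: eq_bigr => a _; rewrite ReZ ImZ ReB ImB; ring.
ring.
Qed.

(** The cross product with z is the inner product with z turned by a right
    angle. *)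
Lemma ray_system_ccross Y F (t : R) p (d z : R[i]) :
  t%:C * d + \sum_a (w a)%:C * (F p t - F (tau a p) t) = t%:C * Y p * F p t ->
  t * ccross z d = t * ccross z (Y p * F p t) -
     \sum_a w a * (ccross z (F p t) - ccross z (F (tau a p) t)).
Proof.
move=> /(ray_system_cdot (complex.Im (- z) +i* complex.Re z)).
have cE x : cdot (complex.Im (- z) +i* complex.Re z) x = ccross z x.
  by rewrite /cdot /ccross; case: (z) => a b /=; ring.
by rewrite !cE => ->; congr (_ - _); apply: eq_bigr => a _; rewrite !cE.
Qed.

Lemma is_derive_energy F (t : R) (d : T -> R[i]) :
  (forall p, is_cderive (F p) t (d p)) ->
  is_derive t 1 (energy F) (\sum_p 2 * cdot (F p t) (d p)).
Proof.
move=> dF; apply: is_derive_eq.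
  by apply: is_derive1_sum => p; exact: (is_derive_cdot (dF p) (dF p)).
by apply: eq_bigr => p _; rewrite cdotC mulr2n mulrDl mul1r.
Qed.

Section Uniqueness.
Hypothesis tauK : forall a, involutive (tau a).

(** Since tau a permutes the indices, the a-th coupling term is w a times
    half of a sum of squares |F_p - F_(tau a p)|^2, which only decreases the
    energy. *)
Lemma ray_system_energy_growth Y F (t : R) (d : T -> R[i]) : 0 < t ->
  (forall p, t%:C * d p + \sum_a (w a)%:C * (F p t - F (tau a p) t) =
     t%:C * Y p * F p t) ->
  \sum_p 2 * cdot (F p t) (d p) <=
     2 * (\sum_p `|complex.Re (Y p)|) * energy F t.
Proof.
move=> t0 e; set K := \sum_p `|_|.
have KY p : `|complex.Re (Y p)| <= K.
  by rewrite /K (bigD1 p) //= lerDl sumr_ge0.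
rewrite -mulr_sumr -mulrA ler_pM2l // -(ler_pM2l t0) mulr_sumr.
under eq_bigr do rewrite (ray_system_cdot _ (e _)).
rewrite sumrB; set D := (X in _ - X).
have D0 : 0 <= D.
  rewrite /D exchange_big /=; apply: sumr_ge0 => a _; rewrite -mulr_sumr.
  apply: mulr_ge0 => //; rewrite sumrB subr_ge0.
  have -> : \sum_p cdot (F p t) (F p t) =
      \sum_p (cdot (F p t) (F p t) + cdot (F (tau a p) t) (F (tau a p) t)) / 2.
    rewrite -mulr_suml [in RHS]big_split /=.
    have <- : \sum_p cdot (F p t) (F p t) =
        \sum_p cdot (F (tau a p) t) (F (tau a p) t).
      by rewrite (reindex_inj (inv_inj (tauK a))).
    by field.
  by apply: ler_sum => p _; exact: cdot_le.
suff : \sum_p t * cdot (F p t) (Y p * F p t) <= t * (K * energy F t) by lra.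
rewrite -mulr_sumr ler_pM2l // /energy mulr_sumr; apply: ler_sum => p _.
have -> : cdot (F p t) (Y p * F p t) = complex.Re (Y p) * cdot (F p t) (F p t).
  by rewrite /cdot ReM ImM; ring.
apply: ler_wpM2r; first exact: cdot_ge0.
exact: le_trans (ler_norm _) (KY p).
Qed.

(** Gronwall for the energy of the difference.  At t = 0 the derivative of the
    energy vanishes together with the difference, so the singular
    coefficient 1/t does no harm. *)
Lemma ray_system_unique Y F G : ray_system Y F -> ray_system Y G ->
  (forall p, F p 0 = G p 0) -> forall p (t : R), 0 <= t -> F p t = G p t.
Proof.
move=> sF sG FG0 p t t0.
pose D p (t : R) : R[i] := F p t - G p t; have sD : ray_system Y D by exact: ray_systemB.
pose K : R := \sum_p `|complex.Re (Y p)|.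
suff S0 : energy D t <= 0.
  have := cdot_le_energy D t p => /le_trans/(_ S0) H.
  apply/eqP; rewrite -subr_eq0; apply/eqP/cdot_eq0.
  by apply/eqP; rewrite eq_le H cdot_ge0.
have dS (s : R) : exists2 S' : R, is_derive s 1 (energy D) S' &
    0 <= s -> S' <= 2 * K * energy D s.
  have /choice[d dP] : forall p, exists d, is_cderive (D p) s d /\
      s%:C * d + \sum_a (w a)%:C * (D p s - D (tau a p) s) = s%:C * Y p * D p s.
    by move=> q; have [d ? ?] := sD q s; exists d.
  exists (\sum_p 2 * cdot (D p s) (d p)).
    by apply: is_derive_energy => q; have [] := dP q.
  rewrite le_eqVlt => /orP[/eqP s0|s0].
    rewrite [leLHS]big1; last first.
      by move=> q _; rewrite -s0 /D FG0 subrr /cdot /= !mul0r addr0 mulr0.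
    rewrite /energy big1 ?mulr0 // => q _.
    by rewrite -s0 /D FG0 subrr /cdot /= !mul0r addr0.
  by apply: ray_system_energy_growth => // q; have [] := dP q.
have /choice[S' S'P] : forall s : R, exists S' : R, is_derive s 1 (energy D) S' /\
   (0 <= s -> S' <= 2 * K * energy D s).
  by move=> s; have [S' ? ?] := dS s; exists S'.
pose Z (s : R) := energy D s * expR (- (2 * K) * s).
have dZ (s : R) : is_derive s 1 Z ((S' s - 2 * K * energy D s) * expR (- (2 * K) * s)).
  have de : is_derive s 1 (fun s => expR (- (2 * K) * s))
      (- (2 * K) * expR (- (2 * K) * s)).
    have := is_derive1_expR (is_derive1Z (- (2 * K)) (is_derive_id s 1)).
    by rewrite mulr1.
  have [dE _] := S'P s.
  have dM := is_derive1M dE de; apply: (is_derive_eq dM); ring.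
have : Z t - Z 0 <= 0 * (t - 0).
  apply: (mean_value_le t0 (fun s _ => dZ s)) => s /andP[s0 _].
  rewrite pmulr_lle0 ?expR_gt0 // subr_le0; have [_] := S'P s; exact.
rewrite mul0r subr_le0 {2}/Z mulr0 expR0 mulr1.
have -> : energy D 0 = 0.
  by rewrite /energy big1 // => q _; rewrite /D FG0 subrr /cdot /= !mul0r addr0.
by rewrite /Z pmulr_lle0 ?expR_gt0.
Qed.

End Uniqueness.

End RaySystem.

(** * Oscillatory decay *)

Section OscillatoryDecay.
Variables (R : realType) (I T : finType) (w : I -> R) (tau : I -> T -> T).
Hypothesis w_ge0 : forall a, 0 <= w a.

Let kappa : R := \sum_a w a.

Lemma sum_w_norm_le (f : I -> R) (s : R) : (forall a, `|f a| <= s) ->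
  `|\sum_a w a * f a| <= kappa * s.
Proof.
move=> fs; apply: le_trans (ler_norm_sum _ _ _) _.
rewrite /kappa mulr_suml; apply: ler_sum => a _.
by rewrite normrM (ger0_norm (w_ge0 a)) ler_wpM2l.
Qed.

(** The phases turn Im (F_p^* F_q) into (theta q - theta p) Re (F_p^* F_q); the
    rest of the derivative is O(1/t) times the energy. *)
Lemma ray_system_ccross_deriv (theta : T -> R) F (t : R) p q (d : T -> R[i]) :
  (forall p, t%:C * d p + \sum_a (w a)%:C * (F p t - F (tau a p) t) =
     t%:C * ('i * (theta p)%:C) * F p t) ->
  `|t * (ccross (d p) (F q t) + ccross (F p t) (d q)) -
      t * ((theta q - theta p) * cdot (F p t) (F q t))| <=
   4 * kappa * energy F t.
Proof.
move=> e.
have ccN z1 z2 : ccross z1 z2 = - ccross z2 z1 :> R by rewrite /ccross; ring.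
have Yc z x : ccross z ('i * (theta x)%:C * F x t) = theta x * cdot z (F x t).
  by rewrite /ccross /cdot !ReM !ImM /=; ring.
pose Y p : R[i] := 'i * (theta p)%:C.
have := @ray_system_ccross _ _ _ w tau Y F t p (d p) (F q t) (e p).
have := @ray_system_ccross _ _ _ w tau Y F t q (d q) (F p t) (e q).
rewrite !Yc (ccN (d p)) [cdot (F q t) _]cdotC.
set A := \sum_a _; set B := \sum_a _ => e1 e2.
have bnd x y : `|ccross (F x t) (F y t)| <= energy F t.
  by apply: norm_ccross_le; exact: cdot_le_energy.
have AB : forall x y, `|\sum_a w a * (ccross (F x t) (F y t) -
     ccross (F x t) (F (tau a y) t))| <= kappa * (2 * energy F t).
  move=> x y; apply: sum_w_norm_le => a; apply: le_trans (ler_normB _ _) _.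
  by have := bnd x y; have := bnd x (tau a y); lra.
have := AB q p; have := AB p q; rewrite -/A -/B !ler_norml.
move: A B e1 e2 => A B e1 e2.
by move=> /andP[? ?] /andP[? ?]; apply/andP; split; lra.
Qed.

Variable theta0 : R.
Hypothesis theta0_gt0 : 0 < theta0.

Let L : R := #|T|%:R * kappa / theta0.
Let M : R := 4 * L * (1 + 6 * kappa).

Let kappa_ge0 : 0 <= kappa. Proof. exact: sumr_ge0. Qed.
Let L_ge0 : 0 <= L. Proof. by rewrite divr_ge0 ?(ltW theta0_gt0) // mulr_ge0. Qed.
Let M_ge0 : 0 <= M.
Proof.
by apply: mulr_ge0; [exact: mulr_ge0 | rewrite addr_ge0 // mulr_ge0].
Qed.

Section System.
Variables (theta : T -> R) (F : T -> R -> R[i]).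
Hypothesis theta_gap : forall a p, theta0 <= `|theta (tau a p) - theta p|.
Hypothesis sF : ray_system w tau (fun p => 'i * (theta p)%:C) F.

Let gap a p := theta (tau a p) - theta p.

(** Primitive, up to O(1/t), of the coupling terms
    \sum_p \sum_a w a Re (F_p^* F_(tau a p)) of the energy balance. *)
Definition corrector (t : R) : R :=
  \sum_p \sum_a w a / gap a p * ccross (F p t) (F (tau a p) t).

Definition lyapunov (t : R) : R := energy F t - 2 * (t^-1 * corrector t).

Let gap_neq0 a p : gap a p != 0.
Proof. by rewrite -normr_gt0; exact: lt_le_trans (theta_gap a p). Qed.

Lemma sum_gap_norm_le (f : T -> I -> R) (s : R) : (forall p a, `|f p a| <= s) ->
  `|\sum_p \sum_a w a / gap a p * f p a| <= L * s.
Proof.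
move=> fs; have -> : L * s = \sum_(p : T) kappa * (s / theta0).
  by rewrite sumr_const -mulr_natl /L; ring.
apply: le_trans (ler_norm_sum _ _ _) _; apply: ler_sum => p _.
have -> : \sum_a w a / gap a p * f p a = \sum_a w a * (f p a / gap a p).
  by apply: eq_bigr => a _; ring.
apply: sum_w_norm_le => a; rewrite normrM normfV.
apply: ler_pM => //.
by rewrite lef_pV2 ?posrE ?normr_gt0 //; exact: theta_gap.
Qed.

Lemma norm_corrector_le (t : R) : `|corrector t| <= L * energy F t.
Proof.
apply: sum_gap_norm_le => p a; apply: norm_ccross_le; exact: cdot_le_energy.
Qed.

(** The corrector cancels the coupling terms of the derivative of the energy,
    leaving - (2 kappa / t) times the energy and terms of order 1/t^2. *)
Lemma lyapunov_derive (t : R) : 0 < t -> exists2 V' : R, is_derive t 1 lyapunov V' &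
  t ^+ 2 * V' <= - (2 * kappa * t) * lyapunov t +
     2 * L * (1 + 6 * kappa) * energy F t.
Proof.
move=> t0.
have /choice[d dP] : forall p, exists d, is_cderive (F p) t d /\
    t%:C * d + \sum_a (w a)%:C * (F p t - F (tau a p) t) =
    t%:C * ('i * (theta p)%:C) * F p t.
  by move=> p; have [d ? ?] := sF p t; exists d.
have dF p : is_cderive (F p) t (d p) by have [] := dP p.
have e p : t%:C * d p + \sum_a (w a)%:C * (F p t - F (tau a p) t) =
    t%:C * ('i * (theta p)%:C) * F p t by have [] := dP p.
pose S' : R := \sum_p 2 * cdot (F p t) (d p).
pose q p a : R := ccross (d p) (F (tau a p) t) + ccross (F p t) (d (tau a p)).
pose Q' : R := \sum_p \sum_a w a / gap a p * q p a.
pose P : R := \sum_p \sum_a w a * cdot (F p t) (F (tau a p) t).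
have dS : is_derive t 1 (energy F) S' by exact: is_derive_energy.
have dQ : is_derive t 1 corrector Q'.
  apply: is_derive1_sum => p; apply: is_derive1_sum => a.
  by apply: is_derive1Z; exact: is_derive_ccross.
have dV := is_derive1B dS (is_derive1Z 2 (is_derive1M (is_derive1_inv t0) dQ)).
exists (S' - 2 * (- t ^- 2 * corrector t + t^-1 * Q')); first exact: dV.
have eS : t * S' = 2 * (P - kappa * energy F t).
  rewrite /S' -mulr_sumr mulrCA mulr_sumr; congr (2 * _).
  rewrite /P /energy mulr_sumr -sumrB; apply: eq_bigr => p _.
  rewrite (@ray_system_cdot _ _ _ w tau (fun p => 'i * (theta p)%:C) F t p
    (d p) (F p t) (e p)).
  have -> : cdot (F p t) ('i * (theta p)%:C * F p t) = 0.
    by rewrite /cdot !ReM !ImM /=; ring.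
  rewrite mulr0 sub0r -sumrN /kappa mulr_suml -sumrB; apply: eq_bigr => a _; ring.
have eQ : `|t * Q' - t * P| <= L * (4 * kappa * energy F t).
  have -> : t * Q' - t * P = \sum_p \sum_a w a / gap a p *
      (t * q p a - t * (gap a p * cdot (F p t) (F (tau a p) t))).
    rewrite /Q' /P !mulr_sumr -sumrB; apply: eq_bigr => p _.
    rewrite !mulr_sumr -sumrB; apply: eq_bigr => a _.
    by field; exact: gap_neq0.
  by apply: sum_gap_norm_le => p a; exact: ray_system_ccross_deriv.
have bQ := norm_corrector_le t.
have -> : t ^+ 2 * (S' - 2 * (- t ^- 2 * corrector t + t^-1 * Q')) =
   t * (t * S') + 2 * corrector t - 2 * (t * Q').
  by field; exact: lt0r_neq0.
have -> : - (2 * kappa * t) * lyapunov t =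
   - (2 * kappa * t) * energy F t + 4 * (kappa * corrector t).
  by rewrite /lyapunov; field; exact: lt0r_neq0.
have kQ : `|kappa * corrector t| <= kappa * (L * energy F t).
  by rewrite normrM (ger0_norm kappa_ge0) ler_wpM2l.
rewrite eS; move: eQ bQ kQ; rewrite !ler_norml => /andP[? ?] /andP[? ?] /andP[? ?].
lra.
Qed.

Lemma lyapunov_bounds (t : R) : 1 <= t -> 4 * L <= t ->
  energy F t / 2 <= lyapunov t <= 2 * energy F t.
Proof.
move=> t1 tL; have t0 : 0 < t by exact: lt_le_trans t1.
have := norm_corrector_le t; have S0 := energy_ge0 F t.
have tQ : `|t^-1 * corrector t| <= energy F t / 4.
  rewrite normrM gtr0_norm ?invr_gt0 // ler_pdivrMl //.
  apply: le_trans (norm_corrector_le t) _.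
  by have := ler_wpM2r S0 tL; lra.
move: tQ; rewrite /lyapunov !ler_norml => /andP[? ?] _; apply/andP; split; lra.
Qed.

(** The integrating factor of V' <= (- 2 kappa / t + M / t^2) V is
    exp (2 kappa ln t + M / t). *)
Lemma energy_decay (s t : R) : 1 <= s -> 4 * L <= s -> s <= t ->
  expR (2 * kappa * ln t) * energy F t <=
    4 * expR (2 * kappa * ln s + M) * energy F s.
Proof.
move=> s1 sL st.
have /choice[V' V'P] : forall x : R, exists V' : R, 0 < x ->
    is_derive x 1 lyapunov V' /\
    x ^+ 2 * V' <= - (2 * kappa * x) * lyapunov x +
     2 * L * (1 + 6 * kappa) * energy F x.
  move=> x; have [x0|x0] := ltP 0 x; last by exists 0.
  by have [V' ? ?] := lyapunov_derive x0; exists V'.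
pose g (x : R) := 2 * kappa * ln x + M * x^-1.
pose g' (x : R) := 2 * kappa * x^-1 + M * (- x ^- 2).
have dZ (x : R) : s <= x <= t -> is_derive x 1 (fun x => lyapunov x * expR (g x))
    ((V' x + lyapunov x * g' x) * expR (g x)).
  move=> /andP[sx _]; have x0 : 0 < x by rewrite (lt_le_trans _ sx) // (lt_le_trans _ s1).
  have [dV _] := V'P x x0.
  have dg : is_derive x 1 g (g' x).
    apply: is_derive1D; apply: is_derive1Z; [exact: is_derive1_ln | exact: is_derive1_inv].
  apply: (is_derive_eq (is_derive1M dV (is_derive1_expR dg))); ring.
have : lyapunov t * expR (g t) - lyapunov s * expR (g s) <= 0 * (t - s).
  apply: (mean_value_le st dZ) => x /andP[sx _].
  have x1 : 1 <= x by exact: le_trans sx.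
  have x0 : 0 < x by exact: lt_le_trans x1.
  rewrite pmulr_lle0 ?expR_gt0 // -(pmulr_rle0 _ (exprn_gt0 2 x0)).
  have [_ dV] := V'P x x0.
  have /andP[lo _] := lyapunov_bounds x1 (le_trans sL sx).
  have -> : x ^+ 2 * (V' x + lyapunov x * g' x) =
      x ^+ 2 * V' x + lyapunov x * (2 * kappa * x - M).
    by rewrite /g'; field; exact: lt0r_neq0.
  have : 2 * L * (1 + 6 * kappa) * energy F x <= M * lyapunov x.
    have -> : 2 * L * (1 + 6 * kappa) * energy F x = M * (energy F x / 2).
      by rewrite /M; field.
    by rewrite ler_wpM2l.
  lra.
rewrite mul0r subr_le0 => Zts.
have t1 : 1 <= t by exact: le_trans st.
have s0 : 0 < s by exact: lt_le_trans s1.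
have t0 : 0 < t by exact: lt_le_trans t1.
have /andP[lo _] := lyapunov_bounds t1 (le_trans sL st).
have /andP[_ up] := lyapunov_bounds s1 sL.
have e1 : expR (2 * kappa * ln t) <= expR (g t).
  by rewrite ler_expR /g lerDl mulr_ge0 // invr_ge0 ltW.
have e2 : expR (g s) <= expR (2 * kappa * ln s + M).
  by rewrite ler_expR /g lerD2l -[leRHS]mulr1 ler_wpM2l // invf_le1.
have h1 : expR (2 * kappa * ln t) * energy F t <= expR (g t) * (2 * lyapunov t).
  apply: ler_pM; rewrite ?expR_ge0 ?energy_ge0 //; lra.
have h2 : lyapunov s * expR (g s) <= 2 * energy F s * expR (2 * kappa * ln s + M).
  apply: ler_pM; rewrite ?expR_ge0 //.
  by apply: le_trans (_ : energy F s / 2 <= _); have := energy_ge0 F s;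
    have /andP[] := lyapunov_bounds s1 sL; lra.
lra.
Qed.

End System.

(** The constants s and C depend on the weights, the number of indices and the
    gap theta0, and not on the phases or on the solution: this is the source of
    the uniformity in x and y. *)
Lemma ray_system_decay : exists s C : R, [/\ 1 <= s, 0 < C &
  forall (theta : T -> R) (F : T -> R -> R[i]),
    (forall a p, theta0 <= `|theta (tau a p) - theta p|) ->
    ray_system w tau (fun p => 'i * (theta p)%:C) F ->
    forall t : R, s <= t -> expR (2 * kappa * ln t) * energy F t <= C * energy F s].
Proof.
exists (1 + 4 * L), (4 * expR (2 * kappa * ln (1 + 4 * L) + M)).
have L4 : 0 <= 4 * L by rewrite mulr_ge0.
split; rewrite ?lerDl // ?mulr_gt0 ?expR_gt0 // => theta F gap sF t st.
by apply: (@energy_decay theta F) => //; lra.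
Qed.

End OscillatoryDecay.

(** * Reflections and root systems *)

Section DotProduct.
Variables (R : realType) (n : nat).
Implicit Types (a b x y : 'rV[R]_n).

Lemma dotpC x y : dotp x y = dotp y x.
Proof. by apply: eq_bigr => j _; rewrite mulrC. Qed.

Lemma dotpDl x y z : dotp (x + y) z = dotp x z + dotp y z.
Proof. by rewrite /dotp -big_split; apply: eq_bigr => j _; rewrite mxE mulrDl. Qed.

Lemma dotpZl (c : R) x y : dotp (c *: x) y = c * dotp x y.
Proof. by rewrite /dotp mulr_sumr; apply: eq_bigr => j _; rewrite mxE mulrA. Qed.

Lemma dotpDr x y z : dotp x (y + z) = dotp x y + dotp x z.
Proof. by rewrite ![dotp x _]dotpC dotpDl. Qed.

Lemma dotpZr (c : R) x y : dotp x (c *: y) = c * dotp x y.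
Proof. by rewrite ![dotp x _]dotpC dotpZl. Qed.

Lemma dotpNl x y : dotp (- x) y = - dotp x y.
Proof. by rewrite -scaleN1r dotpZl mulN1r. Qed.

Lemma dotpNr x y : dotp x (- y) = - dotp x y.
Proof. by rewrite dotpC dotpNl dotpC. Qed.

Lemma dotpBl x y z : dotp (x - y) z = dotp x z - dotp y z.
Proof. by rewrite dotpDl dotpNl. Qed.

Lemma dotpBr x y z : dotp x (y - z) = dotp x y - dotp x z.
Proof. by rewrite dotpDr dotpNr. Qed.

Lemma dotp0l x : dotp 0 x = 0.
Proof. by rewrite -[X in dotp X](scale0r 0) dotpZl mul0r. Qed.

Lemma dotp_sumr (I : finType) x (f : I -> 'rV[R]_n) :
  dotp x (\sum_i f i) = \sum_i dotp x (f i).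
Proof.
apply: (big_morph (dotp x)); first exact: dotpDr.
by rewrite dotpC dotp0l.
Qed.

Lemma dotp_ge0 x : 0 <= dotp x x.
Proof. by apply: sumr_ge0 => j _; rewrite -expr2 sqr_ge0. Qed.

Lemma dotp_gt0 x : x != 0 -> 0 < dotp x x.
Proof.
move=> x0; rewrite lt_def dotp_ge0 andbT; apply: contraNneq x0 => /eqP.
rewrite psumr_eq0; last by move=> j _; rewrite -expr2 sqr_ge0.
move=> /allP x0; apply/eqP/rowP => j; rewrite mxE; apply/eqP.
by have := x0 j (mem_index_enum _); rewrite /= -expr2 sqrf_eq0.
Qed.

Lemma enorm_gt0 x : x != 0 -> 0 < enorm x.
Proof. by move=> /dotp_gt0; rewrite sqrtr_gt0. Qed.

Lemma enormZ (c : R) x : enorm (c *: x) = `|c| * enorm x.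
Proof.
by rewrite /enorm dotpZl dotpZr mulrA -expr2 sqrtrM ?sqr_ge0 // sqrtr_sqr.
Qed.

Lemma coord_le_enorm x j : `|x 0 j| <= enorm x.
Proof.
rewrite -sqrtr_sqr ler_sqrt ?dotp_ge0 // /dotp (bigD1 j) //= -expr2 lerDl.
by apply: sumr_ge0 => i _; rewrite -expr2 sqr_ge0.
Qed.

Lemma norm_dotp_le x y (s : R) : (forall j, `|y 0 j| <= s) ->
  `|dotp x y| <= (\sum_j `|x 0 j|) * s.
Proof.
move=> ys; apply: le_trans (ler_norm_sum _ _ _) _; rewrite mulr_suml.
by apply: ler_sum => j _; rewrite normrM ler_wpM2l.
Qed.

Lemma reflectionD a x y : reflection a (x + y) = reflection a x + reflection a y.
Proof. by rewrite /reflection dotpDl mulrDr mulrDl scalerDl opprD addrACA. Qed.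

Lemma reflectionZ a (c : R) x : reflection a (c *: x) = c *: reflection a x.
Proof.
rewrite /reflection dotpZl scalerBr scalerA; congr (_ - _ *: _).
by rewrite mulrCA -!mulrA.
Qed.

Lemma reflection_sum (I : finType) a (f : I -> 'rV[R]_n) :
  reflection a (\sum_i f i) = \sum_i reflection a (f i).
Proof.
apply: (big_morph (reflection a)); first exact: reflectionD.
by rewrite -[X in reflection a X](scale0r 0) reflectionZ scale0r.
Qed.

Lemma reflection_orth a x : dotp a x = 0 -> reflection a x = x.
Proof. by rewrite /reflection dotpC => ->; rewrite mulr0 mul0r scale0r subr0. Qed.

Lemma reflectionN a x : reflection (- a) x = reflection a x.
Proof. by rewrite /reflection !dotpNr dotpNl opprK mulrN mulNr scalerN scaleNr opprK. Qed.

Section Reflection.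
Variable a : 'rV[R]_n.
Hypothesis a_neq0 : a != 0.
Let aa_neq0 : dotp a a != 0. Proof. exact/lt0r_neq0/dotp_gt0. Qed.

Lemma reflection_self : reflection a a = - a.
Proof.
rewrite /reflection mulfK // scaler_nat mulr2n opprD addrA subrr sub0r //.
Qed.

Lemma dotp_reflection x y : dotp (reflection a x) (reflection a y) = dotp x y.
Proof.
rewrite /reflection !(dotpBl, dotpBr, dotpZl, dotpZr) [dotp a y]dotpC.
by field.
Qed.

Lemma reflectionK : involutive (reflection a).
Proof.
move=> x; rewrite {2}/reflection -scaleNr reflectionD reflectionZ reflection_self.
by rewrite scaleNr scalerN opprK /reflection subrK.
Qed.

Lemma dotp_reflection_r x y : dotp x (reflection a y) = dotp (reflection a x) y.
Proof. by rewrite -dotp_reflection reflectionK. Qed.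

Lemma dotp_reflection_sub x y :
  dotp (reflection a x) y - dotp x y = - (2 / dotp a a) * (dotp x a * dotp y a).
Proof.
by rewrite /reflection dotpBl dotpZl [dotp y a]dotpC; field.
Qed.

Lemma reflection_conj b x :
  reflection (reflection a b) (reflection a x) = reflection a (reflection b x).
Proof.
rewrite {1}/reflection !dotp_reflection [reflection b x]/reflection -!scaleNr.
by rewrite reflectionD reflectionZ.
Qed.

End Reflection.

End DotProduct.

Section RootSystem.
Variables (R : realType) (n : nat) (Phi Pos : {fset 'rV[R]_n}).
Hypothesis rootPhi : reduced_root_system Phi.
Hypothesis posPos : positive_subsystem Phi Pos.
Implicit Types (a b x y : 'rV[R]_n).

Lemma root_neq0 a : a \in Phi -> a != 0.
Proof. by case: rootPhi => Phi0 _ _ _; apply: contraTneq => ->. Qed.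

Lemma root_reflection a b : a \in Phi -> b \in Phi -> reflection a b \in Phi.
Proof. by case: rootPhi => _ _ + _; apply. Qed.

Lemma rootN a : a \in Phi -> - a \in Phi.
Proof.
by move=> aPhi; rewrite -reflection_self ?root_neq0 // root_reflection.
Qed.

Lemma Pos_root a : a \in Pos -> a \in Phi.
Proof. by have [b _ ->] := posPos => /andP[]. Qed.

Lemma PosN a : a \in Phi -> (- a \in Pos) = (a \notin Pos).
Proof.
have [b b0 PosE] := posPos => aPhi; rewrite !PosE rootN // aPhi /=.
by rewrite dotpNl oppr_gt0 -leNgt le_eqVlt (negbTE (b0 a aPhi)).
Qed.

(** The positive roots are not stable under a reflection, the full system is:
    passing to it is what allows reindexing by reflections. *)
Lemma sum_Pos_even (V : zmodType) (G : 'rV[R]_n -> V) :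
  (forall a, a \in Phi -> G (- a) = G a) ->
  (\sum_(a <- Pos) G a) *+ 2 = \sum_(a : Phi) G (val a).
Proof.
move=> Geven.
have -> : \sum_(a <- Pos) G a = \sum_(a : Phi | val a \in Pos) G (val a).
  rewrite -[RHS](big_seq_fsetE _ Phi (fun a => a \in Pos) G) /=.
  rewrite -[RHS]big_filter; apply: perm_big; apply: uniq_perm.
  - exact: fset_uniq.
  - by rewrite filter_uniq // fset_uniq.
  - move=> a; rewrite mem_filter; case: (boolP (a \in Pos)) => //= /Pos_root aPhi.
    by rewrite aPhi.
pose opp (a : Phi) : Phi := insubd a (- val a).
have oppE (a : Phi) : val (opp a) = - val a by rewrite val_insubd rootN // fsvalP.
have oppK : involutive opp by move=> a; apply: val_inj; rewrite !oppE opprK.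
rewrite [RHS](bigID (fun a : Phi => val a \in Pos)) /=.
have -> : \sum_(a : Phi | val a \notin Pos) G (val a) =
    \sum_(a : Phi | val a \in Pos) G (val a).
  rewrite (reindex_inj (inv_inj oppK)) /=; apply: eq_big => a.
    by rewrite oppE PosN ?fsvalP // negbK.
  by move=> _; rewrite oppE Geven // fsvalP.
by rewrite mulr2n.
Qed.

(** Reflections are involutions, so inverses are reversed words. *)
Lemma reflection_group_word g : reflection_group Phi g ->
  exists2 s : seq 'rV[R]_n, {subset s <= Phi} &
    forall x, g x = foldr (@reflection R n) x s.
Proof.
elim=> {g}.
- move=> a aPhi; exists [:: a] => // b; by rewrite inE => /eqP ->.
- by exists [::].
- move=> g h _ [s sPhi gE] _ [r rPhi hE]; exists (s ++ r).
    by move=> a; rewrite mem_cat => /orP[/sPhi|/rPhi].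
  by move=> x; rewrite foldr_cat /= hE gE.
- move=> g h _ [s sPhi gE] gh hg; exists (rev s).
    by move=> a; rewrite mem_rev => /sPhi.
  have gK x : g (foldr (@reflection R n) x (rev s)) = x.
    rewrite gE; elim: s sPhi {gE} x => [//|a s IH] sPhi x /=.
    rewrite rev_cons -cats1 foldr_cat /= IH; last first.
      by move=> b bs; apply: sPhi; rewrite inE bs orbT.
    by rewrite reflectionK // root_neq0 // sPhi // mem_head.
  by move=> x; rewrite -{1}(gK x) gh.
Qed.

Variables (al lam : 'I_n -> 'rV[R]_n).
Hypothesis simple : simple_roots Pos al.
Hypothesis dual : dual_basis al lam.

(** The linear map sending the i-th simple root to f i.  Indexing linear maps by
    arbitrary families of n roots gives a finite type stable under reflections
    for free, and avoids proving that the reflection group is finite. *)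
Definition place (f : {ffun 'I_n -> Phi}) x : 'rV[R]_n :=
  \sum_i dotp (lam i) x *: val (f i).

Definition reflect_frame (a : Phi) (f : {ffun 'I_n -> Phi}) : {ffun 'I_n -> Phi} :=
  [ffun i => insubd (f i) (reflection (val a) (val (f i)))].

Lemma reflect_frameE (a : Phi) f i :
  val (reflect_frame a f i) = reflection (val a) (val (f i)).
Proof. by rewrite ffunE val_insubd root_reflection ?fsvalP. Qed.

Lemma place_reflect_frame (a : Phi) f x :
  place (reflect_frame a f) x = reflection (val a) (place f x).
Proof.
rewrite /place reflection_sum; apply: eq_bigr => i _.
by rewrite reflect_frameE reflectionZ.
Qed.

Lemma reflect_frameK (a : Phi) : involutive (reflect_frame a).
Proof.
move=> f; apply/ffunP => i; apply: val_inj.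
by rewrite !reflect_frameE reflectionK // root_neq0 // fsvalP.
Qed.

Lemma placeZ f (c : R) x : place f (c *: x) = c *: place f x.
Proof.
rewrite /place scaler_sumr; apply: eq_bigr => i _.
by rewrite dotpZr scalerA.
Qed.

Lemma dual_basis_expansion x : x = \sum_i dotp (lam i) x *: al i.
Proof.
have [_ al_basis _] := simple.
have : x \in <<codom al>>%VS by rewrite (span_basis al_basis) memvf.
rewrite span_def /codom /image_mem big_map big_enum /= => /memv_sumP[v vP xE].
have /choice[c cP] : forall i, exists c : R, v i = c *: al i.
  by move=> i; apply/vlineP/vP.
have cE j : c j = dotp (lam j) x.
  rewrite xE dotp_sumr (bigD1 j) //= big1 ?addr0.
    by rewrite cP dotpZr dual eqxx mulr1.
  by move=> i /negbTE ij; rewrite cP dotpZr dual eq_sym ij mulr0.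
by rewrite {1}xE; apply: eq_bigr => i _; rewrite cP cE.
Qed.

Lemma exists_identity_frame : exists f : {ffun 'I_n -> Phi}, forall x, place f x = x.
Proof.
have al_root i : al i \in Phi by apply: Pos_root; have [] := simple.
exists [ffun i => [` al_root i]%fset] => x.
by rewrite [RHS]dual_basis_expansion; apply: eq_bigr => i _; rewrite ffunE.
Qed.

Lemma weyl_subcone_neq0 (delta : R) x : Pos != fset0 -> weyl_subcone Pos lam delta x -> x != 0.
Proof.
case/fset0Pn => a aPos [[t t0 xE] _].
apply: contra_neq (root_neq0 (Pos_root aPos)) => x0.
apply/rowP => j; have := dual j j; rewrite eqxx => dj; exfalso.
have : dotp x (al j) = t j.
  rewrite xE dotpC dotp_sumr (bigD1 j) //= big1 ?addr0.
    by rewrite dotpZr dotpC dj mulr1.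
  by move=> i /negbTE ij; rewrite dotpZr dotpC dual ij mulr0.
by rewrite x0 dotp0l => tj; have := t0 j; rewrite -tj ltxx.
Qed.

Lemma weyl_subcone_gap (delta : R) x a : weyl_subcone Pos lam delta x -> a \in Phi ->
  delta * enorm x <= `|dotp x a|.
Proof.
move=> [_ xd] aPhi; have [aPos|aNPos] := boolP (a \in Pos).
  exact: le_trans (xd a aPos) (ler_norm _).
have Na : - a \in Pos by rewrite PosN.
by rewrite -normrN -dotpNr; exact: le_trans (xd _ Na) (ler_norm _).
Qed.

(** Stated as the inequality that is used rather than as membership in the
    reflection group: it holds for the identity, passes from f to sigma_a f
    because reflections permute the roots, and so holds for the whole group. *)
Definition regular_frame (delta : R) (f : {ffun 'I_n -> Phi}) :=
  `[< forall y, weyl_subcone Pos lam delta y -> forall a, a \in Phi ->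
       delta * enorm y <= `|dotp (place f y) a| >].

Lemma regular_reflect_frame delta (a : Phi) f :
  regular_frame delta f -> regular_frame delta (reflect_frame a f).
Proof.
move=> /asboolP reg; apply/asboolP => y yC b bPhi.
have a0 : val a != 0 by rewrite root_neq0 // fsvalP.
rewrite place_reflect_frame -dotp_reflection_r //.
by apply: reg => //; rewrite root_reflection // fsvalP.
Qed.

Lemma reflection_group_frame (delta : R) g : reflection_group Phi g ->
  exists2 f, regular_frame delta f & forall x, place f x = g x.
Proof.
move=> /reflection_group_word[s sPhi gE].
have [f freg fE] : exists2 f, regular_frame delta f &
    forall x, place f x = foldr (@reflection R n) x s.
  elim: s sPhi {gE} => [_|a s IH sPhi].
    have [f fE] := exists_identity_frame; exists f => //.
    by apply/asboolP => y yC b bPhi; rewrite fE weyl_subcone_gap.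
  have [f freg fE] : exists2 f, regular_frame delta f &
      forall x, place f x = foldr (@reflection R n) x s.
    by apply: IH => b bs; apply: sPhi; rewrite inE bs orbT.
  have aPhi : a \in Phi by rewrite sPhi // mem_head.
  exists (reflect_frame [` aPhi]%fset f); first exact: regular_reflect_frame.
  by move=> x; rewrite place_reflect_frame fE.
by exists f => // x; rewrite fE gE.
Qed.

End RootSystem.

(** * The Dunkl kernel along rays and its symmetries *)

Section KernelRays.
Variables (R : realType) (n : nat) (Phi Pos : {fset 'rV[R]_n}).
Variables (k : 'rV[R]_n -> R) (E : 'rV[R[i]]_n -> 'rV[R[i]]_n -> R[i]).
Hypothesis rootPhi : reduced_root_system Phi.
Hypothesis posPos : positive_subsystem Phi Pos.
Hypothesis mult_k : multiplicity_function Phi k.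
Hypothesis kernelE : is_dunkl_kernel Pos k E.
Implicit Types (a b x p : 'rV[R]_n) (z : R[i]).
Local Notation normc := (@Normc.normc R).

Definition kernel z x p : R[i] := E (cvec x) (z *: cvec p).

Lemma cvecZ (c : R) x : cvec (c *: x) = c%:C *: cvec x.
Proof. by apply/rowP => j; rewrite !mxE rmorphM. Qed.

Lemma dotp_cvec x y : dotp (cvec x) (cvec y) = (dotp x y)%:C.
Proof. by rewrite /dotp rmorph_sum; apply: eq_bigr => j _; rewrite !mxE rmorphM. Qed.

Lemma kernel0 z p : kernel z 0 p = 1.
Proof. by have [_ /(_ (z *: cvec p))[]] := kernelE. Qed.

(** Differentiating along the direction (v, 0) at (c v, y) is differentiating in
    c. *)
Lemma derivable_kernel_l (v y : 'rV[R[i]]_n) (c : R[i]) :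
  derivable (fun c : R[i]^o => E (c *: v) y : R[i]^o) c 1.
Proof.
have [hol _] := kernelE.
have /(@diff_derivable _ _ _ _ _ (v : 'rV[R[i]^o]_n, 0 : 'rV[R[i]^o]_n)) :=
  hol (c *: v : 'rV[R[i]^o]_n, y : 'rV[R[i]^o]_n).
rewrite /derivable; set d := (fun h => _); set d' := (fun h => _).
suff -> : d = d' by []; apply/funext => h; rewrite /d /d' /=.
by rewrite scaler0 add0r [h%:A]mulr1 -scalerDl.
Qed.

Lemma derivable_kernel_r (v y : 'rV[R[i]]_n) (c : R[i]) :
  derivable (fun c : R[i]^o => E v (c *: y) : R[i]^o) c 1.
Proof.
have [hol _] := kernelE.
have /(@diff_derivable _ _ _ _ _ (0 : 'rV[R[i]^o]_n, y : 'rV[R[i]^o]_n)) :=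
  hol (v : 'rV[R[i]^o]_n, c *: y : 'rV[R[i]^o]_n).
rewrite /derivable; set d := (fun h => _); set d' := (fun h => _).
suff -> : d = d' by []; apply/funext => h; rewrite /d /d' /=.
by rewrite scaler0 add0r [h%:A]mulr1 -scalerDl.
Qed.

Lemma derivable_real_part (f : R[i]^o -> R[i]^o) (s : R) :
  derivable f s%:C 1 ->
  exists D, is_cderive (fun s : R => f s%:C) s D.
Proof.
move=> /derivable_normc_approx[D DP]; exists D.
have aux (g : R[i] -> R) : (forall x y : R[i], g (x - y) = g x - g y) ->
    (forall (c : R) (x : R[i]), g (c%:C * x) = c * g x) ->
    (forall x : R[i], `|g x| <= normc x) ->
    is_derive s 1 (fun s : R => g (f s%:C)) (g D).
  move=> gB gZ gle.
  suff H : (fun h : R => h^-1 *: (((fun s : R => g (f s%:C)) \o shift s) (h *: 1) - g (f s%:C)))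
      @ 0^' --> g D.
    apply: DeriveDef; first by apply/cvg_ex; exists (g D).
    by apply/cvg_lim.
  apply/cvgrPdist_le => e e0; rewrite near_withinE; apply/nbhs_ballP.
  have [d d0 dP] := DP e e0; exists d => //= h; rewrite /ball /= sub0r normrN => hd h0.
  have hd' : normc h%:C < d by rewrite normc_real.
  have := dP _ hd'; rewrite normc_real -rmorphD /= [h *: 1]mulr1 [h + s]addrC => H.
  rewrite -(ler_pM2r (_ : 0 < `|h|)) ?normr_gt0 // -normrM mulrBl.
  apply: le_trans H; rewrite distrC /GRing.scale /= [h^-1 * _]mulrC divfK //.
  have -> : g (f (s + h)%:C) - g (f s%:C) - g D * h = g (f (s + h)%:C - f s%:C - D * h%:C).
    by rewrite 2!gB [D * _]mulrC gZ [h * _]mulrC.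
  exact: gle.
split; apply: aux.
- exact: ReB. - exact: ReZ. - exact: norm_Re_le.
- exact: ImB. - exact: ImZ. - exact: norm_Im_le.
Qed.

Lemma derive_along_ray (g : 'rV[R]_n -> R) x (s : R) :
  'D_x g (s *: x) = 'D_1 (fun r : R => g (r *: x)) s.
Proof.
rewrite /derive; set d := (fun _ => _); set d' := (fun _ => _).
suff -> : d = d' by []; apply/funext => h; rewrite /d /d' /=.
by rewrite [h%:A]mulr1 scalerDl.
Qed.

(** The factor 1/2 compensates for summing over all roots instead of the
    positive ones. *)
Definition half_mult (a : Phi) : R := k (val a) / 2.

Lemma half_mult_ge0 (a : Phi) : 0 <= half_mult a.
Proof. by case: mult_k => k0 _; rewrite divr_ge0 // k0 // fsvalP. Qed.

Lemma mult_root_opp a : a \in Phi -> k (- a) = k a.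
Proof.
move=> aPhi; have [_ kG] := mult_k.
by rewrite -reflection_self ?(root_neq0 rootPhi) // kG //; exact: RefGen.
Qed.

(** The Dunkl equation in the direction x at the point s x.  The factor s turns
    <a, x> / <a, s x> into 1; on a wall both the coefficient and the difference
    vanish. *)
Lemma kernel_ray z x p (s : R) :
  exists2 d, is_cderive (fun s : R => kernel z (s *: x) p) s d &
    s%:C * d + \sum_(a : Phi) (half_mult a)%:C *
        (kernel z (s *: x) p - kernel z (s *: reflection (val a) x) p) =
    s%:C * (z * (dotp p x)%:C) * kernel z (s *: x) p.
Proof.
have dk := @derivable_kernel_l (cvec x) (z *: cvec p) s%:C.
have [d ed] : exists d, is_cderive (fun s : R => kernel z (s *: x) p) s d.
  have [d] := derivable_real_part dk; exists d.
  by rewrite /kernel; under eq_fun do rewrite cvecZ.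
exists d => //.
have [_ /(_ (z *: cvec p))[_ _ /(_ x (s *: x))]] := kernelE.
rewrite -/(kernel z (s *: x) p) /dunkl_operator.
have -> : ddir x (fun x0 => E (cvec x0) (z *: cvec p)) (s *: x) = d.
  rewrite /ddir !derive_along_ray; case: ed => [er ei].
  case: d er ei => dr di er ei.
  by rewrite (derive_val (is_derive := er)) (derive_val (is_derive := ei)).
have -> : dotp (z *: cvec p) (cvec x) = z * (dotp p x)%:C.
  by rewrite -dotp_cvec /dotp mulr_sumr; apply: eq_bigr => j _; rewrite !mxE mulrA.
move=> dunkl; rewrite -mulrA -dunkl mulrDr; congr (_ + _).
pose G a : R[i] := (k a)%:C * (kernel z (s *: x) p - kernel z (s *: reflection a x) p).
have -> : \sum_(a : Phi) (half_mult a)%:C *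
    (kernel z (s *: x) p - kernel z (s *: reflection (val a) x) p) =
    (\sum_(a : Phi) G (val a)) / 2.
  rewrite mulr_suml; apply: eq_bigr => a _.
  by rewrite /half_mult /G rmorphM fmorphV rmorph_nat mulrAC.
rewrite -(sum_Pos_even rootPhi posPos); last first.
  by move=> a aPhi; rewrite /G mult_root_opp // reflectionN.
have half (v : R[i]) : v *+ 2 / 2 = v by rewrite -[v *+ 2]mulr_natr mulfK // pnatr_eq0.
rewrite half mulr_sumr big_seq [RHS]big_seq.
apply: eq_bigr => a aPos; rewrite /G /dunkl_quotient dotpZr.
have [sax0|sax0] := eqVneq (s * dotp a x) 0.
  rewrite -reflectionZ reflection_orth ?dotpZr // subrr mulr0.
  have sk0 : s * (k a * dotp a x) = 0 by rewrite mulrCA sax0 mulr0.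
  by rewrite mulrA -rmorphM /= sk0 mul0r.
have sC : (s * dotp a x)%:C != 0 by rewrite fmorph_eq0.
rewrite -reflectionZ -/(kernel _ _ _) -/(kernel _ _ _).
rewrite !rmorphM /= in sC *.
by field; move: sC; rewrite mulf_eq0 negb_or => /andP[-> ->].
Qed.

Section KernelSymmetries.
Variables (al lam : 'I_n -> 'rV[R]_n).
Hypothesis simple : simple_roots Pos al.
Hypothesis dual : dual_basis al lam.

Let frame_system := ray_system half_mult (@reflect_frame R n Phi).

(** The map y is a scaling or a reflection and rho the permutation of the roots
    it induces on reflections; both symmetries of the kernel compare the system
    built on y with the one built on the identity. *)
Lemma kernel_ray_system z x p (y : 'rV[R]_n -> 'rV[R]_n) (Y : {ffun 'I_n -> Phi} -> R[i])
    (rho : Phi -> Phi) : bijective rho ->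
  (forall a : Phi, k (val (rho a)) = k (val a)) ->
  (forall (a : Phi) v, reflection (val (rho a)) (y v) = y (reflection (val a) v)) ->
  (forall f, Y f = z * (dotp p (y (place lam f x)))%:C) ->
  frame_system Y (fun f t => kernel z (t *: y (place lam f x)) p).
Proof.
move=> rho_bij k_rho y_rho YE f t.
have [d dF e] := kernel_ray z (y (place lam f x)) p t; exists d => //.
rewrite YE -e; congr (_ + _).
rewrite [RHS](reindex rho); last exact: onW_bij.
apply: eq_bigr => a _; rewrite /half_mult k_rho y_rho.
by rewrite (place_reflect_frame rootPhi).
Qed.

(** Both sides, along t x, solve the system with phases c z <p, x> and
    equal 1 at t = 0. *)
Lemma kernel_scale z (c : R) x p : kernel z (c *: x) p = kernel (c%:C * z) x p.
Proof.
pose Y (f : {ffun 'I_n -> Phi}) : R[i] := c%:C * z * (dotp p (place lam f x))%:C.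
have idb : bijective (id : Phi -> Phi) by exists id.
have sF : frame_system Y (fun f t => kernel z (t *: (c *: place lam f x)) p).
  apply: (@kernel_ray_system z x p (fun v => c *: v) Y id idb) => //.
    by move=> a v; rewrite reflectionZ.
  by move=> f; rewrite /Y dotpZr rmorphM /=; ring.
have sG : frame_system Y (fun f t => kernel (c%:C * z) (t *: place lam f x) p).
  exact: (@kernel_ray_system (c%:C * z) x p id Y id idb).
have [f fE] := exists_identity_frame posPos simple dual.
have := ray_system_unique half_mult_ge0 (reflect_frameK rootPhi) sF sG _ f ler01.
by rewrite !scale1r fE; apply => g; rewrite !scale0r !kernel0.
Qed.

(** Invariance of k makes the system for sigma_b x and sigma_b p the one for x
    and p, up to the permutation a |-> sigma_b a of the roots. *)
Lemma kernel_reflection z b x p : b \in Phi ->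
  kernel z (reflection b x) (reflection b p) = kernel z x p.
Proof.
move=> bPhi; have b0 := root_neq0 rootPhi bPhi.
pose rho (a : Phi) : Phi := insubd a (reflection b (val a)).
have rhoE (a : Phi) : val (rho a) = reflection b (val a).
  by rewrite val_insubd (root_reflection rootPhi) ?fsvalP.
have rhoK : involutive rho.
  by move=> a; apply: val_inj; rewrite !rhoE reflectionK.
pose Y (f : {ffun 'I_n -> Phi}) : R[i] := z * (dotp p (place lam f x))%:C.
have idb : bijective (id : Phi -> Phi) by exists id.
have sF : frame_system Y
    (fun f t => kernel z (t *: reflection b (place lam f x)) (reflection b p)).
  apply: (@kernel_ray_system z x _ (reflection b) Y rho (inv_bij rhoK)).
  - move=> a; rewrite rhoE; have [_ kG] := mult_k.
    by rewrite kG ?fsvalP //; exact: RefGen.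
  - by move=> a v; rewrite rhoE reflection_conj.
  - by move=> f; rewrite /Y dotp_reflection.
have sG : frame_system Y (fun f t => kernel z (t *: place lam f x) p).
  exact: (@kernel_ray_system z x p id Y id idb).
have [f fE] := exists_identity_frame posPos simple dual.
have := ray_system_unique half_mult_ge0 (reflect_frameK rootPhi) sF sG _ f ler01.
by rewrite !scale1r fE; apply => g; rewrite !scale0r !kernel0.
Qed.

(** For real c the function below is an instance of kernel_scale, and it is
    entire in c. *)
Lemma kernel_imaginary x p : E ('i *: cvec x) (cvec p) = kernel 'i x p.
Proof.
pose h (c : R[i]^o) : R[i]^o := E (c *: cvec x) (cvec p) - E (cvec x) (c *: cvec p).
apply/eqP; rewrite -subr_eq0; apply/eqP; apply: (@identity_theorem_at_i R h).
  move=> c; have d1 := @derivable_kernel_l (cvec x) (cvec p) c.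
  exact: (derivableB d1 (@derivable_kernel_r (cvec x) (cvec p) c)).
move=> r; apply/eqP; rewrite subr_eq0; apply/eqP.
have := kernel_scale 1 r x p; rewrite mulr1 /kernel cvecZ scale1r; exact.
Qed.

End KernelSymmetries.

Lemma kernel_bounded z (r : R) : exists2 M : R, 0 < M & forall x p,
  (forall j, `|x 0 j| <= r) -> (forall j, `|p 0 j| <= r) ->
  normc (kernel z x p) <= M.
Proof.
pose A := [set v : 'rV[R]_n | forall j, `[- r, r]%classic (v ord0 j)].
have cA : compact A.
  have := @rV_compact R n (fun=> `[- r, r]%classic); apply=> _.
  exact: segment_compact.
have cont_cvec : continuous (@cvec R n : 'rV[R]_n -> 'rV[R[i]^o]_n).
  move=> x B /nbhs_ballP[e /= e0 eB].
  have [d d0 de] := pos_complex_real e0.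
  apply/nbhs_ballP; exists d => //= y xy; apply: eB; split=> // i j.
  have [_ /(_ i j)] := xy; rewrite /ball /= !mxE -rmorphB normrC -de ltcR.
  by rewrite normc_real.
pose f (v : 'rV[R]_n * 'rV[R]_n) : R[i]^o := E (cvec v.1) (z *: cvec v.2).
have cf : continuous f.
  have [hol _] := kernelE.
  move=> v.
  pose F1 (v : 'rV[R]_n * 'rV[R]_n) : 'rV[R[i]^o]_n := cvec v.1.
  pose F2 (v : 'rV[R]_n * 'rV[R]_n) : 'rV[R[i]^o]_n := cvec v.2.
  pose F3 (v : 'rV[R]_n * 'rV[R]_n) : 'rV[R[i]^o]_n := z *: F2 v.
  pose F v := (F1 v, F3 v).
  have c1 : {for v, continuous F1}.
    exact: (continuous_comp (f := fst) (cvg_fst) (@cont_cvec v.1)).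
  have c2 : {for v, continuous F2}.
    exact: (continuous_comp (f := snd) (cvg_snd) (@cont_cvec v.2)).
  have c3 : {for v, continuous F3}.
    exact: (continuous_comp c2 (@scaler_continuous R[i] 'rV[R[i]^o]_n z _)).
  have cF : {for v, continuous F}.
    exact: (@cvg_pair _ _ _ (nbhs v) (nbhs (F1 v)) (nbhs (F3 v)) _ _ _ F1 F3 c1 c3).
  pose H (w : 'rV[R[i]^o]_n * 'rV[R[i]^o]_n) : R[i]^o := E w.1 w.2.
  have cE : {for F v, continuous H}.
    exact/differentiable_continuous/hol.
  exact: (continuous_comp cF cE).
have bnd (g : R[i] -> R) : (forall x y : R[i], g (x - y) = g x - g y) ->
    (forall x : R[i], `|g x| <= normc x) ->
    exists2 M : R, 0 < M & forall v, (A `*` A) v -> `|g (f v)| <= M.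
  move=> gB gle.
  have cg : continuous (fun v => g (f v)).
    move=> v; apply/cvgrPdist_lt => e e0.
    have e0C : (0 : R[i]) < e%:C by rewrite ltcR.
    have /cvgrPdist_lt /(_ _ e0C) := cf v.
    apply: filterS => w; rewrite normrC ltcR -gB => H.
    exact: le_lt_trans (gle _) H.
  have : compact ((fun v => g (f v)) @` (A `*` A)).
    apply: continuous_compact; last exact: compact_setX.
    exact: continuous_subspaceT.
  move=> /compact_bounded[M [_ MP]]; exists (`|M| + 1); first by rewrite ltr_wpDl.
  move=> v Av; apply: (MP (`|M| + 1)); last by exists v.
  by rewrite (le_lt_trans (ler_norm _)) // ltrDl.
have [M1 M10 M1P] := bnd _ (@ReB R) (@norm_Re_le R).
have [M2 M20 M2P] := bnd _ (@ImB R) (@norm_Im_le R).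
exists (M1 + M2); first exact: addr_gt0.
move=> x p xr pr; apply: le_trans (normc_le_ReIm _) _.
have Axp : (A `*` A) (x, p).
  by split=> j /=; rewrite in_itv /= -ler_norml.
by apply: lerD; [exact: M1P Axp | exact: M2P Axp].
Qed.

End KernelRays.

(** * The uniform bound *)

Section UniformBound.
Variables (R : realType) (n : nat) (Phi Pos : {fset 'rV[R]_n}).
Variables (al lam : 'I_n -> 'rV[R]_n) (k : 'rV[R]_n -> R).
Variable E : 'rV[R[i]]_n -> 'rV[R[i]]_n -> R[i].
Hypothesis rootPhi : reduced_root_system Phi.
Hypothesis posPos : positive_subsystem Phi Pos.
Hypothesis simple : simple_roots Pos al.
Hypothesis dual : dual_basis al lam.
Hypothesis mult_k : multiplicity_function Phi k.
Hypothesis kernelE : is_dunkl_kernel Pos k E.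
Local Notation normc := (@Normc.normc R).
Local Notation K := (kernel E 'i).

Lemma sum_half_mult : \sum_(a : Phi) half_mult k a = gamma_k Pos k.
Proof.
rewrite /half_mult -mulr_suml -(sum_Pos_even rootPhi posPos).
  by rewrite -[_ *+ 2]mulr_natr mulfK // pnatr_eq0.
by move=> a aPhi; rewrite (mult_root_opp rootPhi mult_k).
Qed.

Lemma cdot_normc (z : R[i]) : cdot z z = normc z ^+ 2.
Proof. by rewrite sqr_normcE /cdot -!expr2. Qed.

Section Delta.
Variable delta : R.
Hypothesis delta_gt0 : 0 < delta.

Let frame := {f : {ffun 'I_n -> Phi} | regular_frame Pos lam delta f}.

Definition reflect_regular_frame (a : Phi) (f : frame) : frame :=
  exist _ (reflect_frame a (val f))
    (regular_reflect_frame rootPhi a (valP f)).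

(** Here the second argument moves: kernel_reflection transfers the reflection
    of the first argument, produced by the equation, to the second. *)
Lemma kernel_frame_system x y :
  ray_system (half_mult k) reflect_regular_frame
    (fun f => 'i * (dotp (place lam (val f) y) x)%:C)
    (fun f t => K (t *: x) (place lam (val f) y)).
Proof.
move=> f t; have [d dF e] :=
  kernel_ray rootPhi posPos mult_k kernelE 'i x (place lam (val f) y) t.
exists d; first exact: dF.
rewrite -e; congr (_ + _); apply: eq_bigr => a _.
have a0 := root_neq0 rootPhi (fsvalP a).
rewrite /= (place_reflect_frame rootPhi); congr (_ * (_ - _)).
rewrite -(kernel_reflection rootPhi posPos mult_k kernelE simple dual 'i _ _ (fsvalP a)).
by rewrite reflectionK // reflectionZ.
Qed.

Let phase_gap : R := 2 * delta ^+ 2 / (1 + \sum_(a : Phi) dotp (val a) (val a)).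

Let phase_gap_gt0 : 0 < phase_gap.
Proof.
rewrite divr_gt0 ?mulr_gt0 ?exprn_gt0 // ltr_pwDl // sumr_ge0 // => a _.
exact: dotp_ge0.
Qed.

(** <sigma_a p, x> - <p, x> = - 2 <p, a> <x, a> / <a, a>, and both factors of the
    numerator are at least delta in absolute value. *)
Lemma frame_phase_gap x y (a : Phi) (f : frame) :
  weyl_subcone Pos lam delta x -> weyl_subcone Pos lam delta y ->
  enorm x = 1 -> enorm y = 1 ->
  phase_gap <= `|dotp (place lam (val (reflect_regular_frame a f)) y) x -
                 dotp (place lam (val f) y) x|.
Proof.
move=> xC yC x1 y1; have a0 := root_neq0 rootPhi (fsvalP a).
rewrite (place_reflect_frame rootPhi) dotp_reflection_sub // normrM normrN.
have hx := weyl_subcone_gap rootPhi posPos xC (fsvalP a).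
have hy := asboolP _ (valP f) y yC _ (fsvalP a).
rewrite x1 y1 !mulr1 in hx hy.
have aa := dotp_gt0 a0.
have aa2 : 0 < 2 / dotp (val a) (val a) by exact: divr_gt0.
rewrite (gtr0_norm aa2) normrM /phase_gap mulrAC.
apply: ler_pM; rewrite ?exprn_ge0 ?(ltW delta_gt0) //.
- rewrite divr_ge0 //; by rewrite addr_ge0 // sumr_ge0 // => b _; exact: dotp_ge0.
- rewrite ler_pM2l // lef_pV2 ?posrE //; last first.
    by rewrite ltr_pwDl // sumr_ge0 // => b _; exact: dotp_ge0.
  rewrite (bigD1 a) //= addrCA lerDl addr_ge0 // sumr_ge0 // => b _.
  exact: dotp_ge0.
- by rewrite expr2; apply: ler_pM; rewrite ?(ltW delta_gt0).
Qed.

Let place_size : R :=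
  (\sum_i \sum_j `|lam i 0 j|) * (\sum_(a : Phi) \sum_j `|(val a) 0 j|).

Lemma place_coord_le (f : {ffun 'I_n -> Phi}) y j : enorm y = 1 ->
  `|place lam f y 0 j| <= place_size.
Proof.
move=> y1; rewrite /place summxE; apply: le_trans (ler_norm_sum _ _ _) _.
rewrite /place_size mulr_suml; apply: ler_sum => i _; rewrite mxE normrM.
apply: ler_pM => //.
  rewrite -[leRHS]mulr1; apply: norm_dotp_le => l; rewrite -y1.
  exact: coord_le_enorm.
rewrite (bigD1 (f i)) //= (bigD1 j) //= -addrA lerDl addr_ge0 ?sumr_ge0 //.
by move=> a _; rewrite sumr_ge0.
Qed.

(** Compactness for t <= s, oscillatory decay from s on. *)
Lemma kernel_decay : exists2 c : R, 0 < c & forall x y (f : frame) (t : R),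
  weyl_subcone Pos lam delta x -> weyl_subcone Pos lam delta y ->
  enorm x = 1 -> enorm y = 1 -> 0 < t ->
  expR (gamma_k Pos k * ln t) * normc (K (t *: x) (place lam (val f) y)) <= c.
Proof.
have [s [C [s1 C0 decay]]] := @ray_system_decay R Phi frame (half_mult k)
  reflect_regular_frame (half_mult_ge0 mult_k) phase_gap phase_gap_gt0.
rewrite sum_half_mult in decay.
have gk0 : 0 <= gamma_k Pos k.
  by rewrite -sum_half_mult sumr_ge0 // => a _; exact: half_mult_ge0.
have [M M0 bnd] := kernel_bounded kernelE 'i (s + place_size).
have size0 : 0 <= place_size.
  rewrite mulr_ge0 // sumr_ge0 // => i _; exact: sumr_ge0.
have s0 : 0 < s by exact: lt_le_trans s1.
have near x y (f : frame) (t : R) : enorm x = 1 -> enorm y = 1 -> 0 <= t <= s ->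
    normc (K (t *: x) (place lam (val f) y)) <= M.
  move=> x1 y1 /andP[t0 ts]; apply: bnd => j.
    rewrite mxE normrM (ger0_norm t0); have := coord_le_enorm x j; rewrite x1 => xj.
    by apply: le_trans (ler_wpM2l t0 xj) _; lra.
  by apply: le_trans (place_coord_le (val f) j y1) _; lra.
pose D := C * (#|{: frame}|%:R * M ^+ 2).
have D0 : 0 <= D by rewrite mulr_ge0 ?(ltW C0) // mulr_ge0 // exprn_ge0 // ltW.
exists (expR (gamma_k Pos k * ln s) * M + (D + 1)).
  by rewrite addr_gt0 ?mulr_gt0 ?expR_gt0 // ltr_wpDl.
move=> x y f t xC yC x1 y1 t0; have [st|ts] := leP s t; last first.
  apply: le_trans (_ : expR (gamma_k Pos k * ln s) * M <= _); last first.
    by rewrite lerDl addr_ge0.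
  apply: ler_pM; rewrite ?expR_ge0 ?normc_ge0 //.
    by rewrite ler_expR ler_wpM2l // ler_ln ?posrE // ltW.
  by apply: near => //; rewrite (ltW t0) (ltW ts).
pose F (f : frame) (t : R) := K (t *: x) (place lam (val f) y).
have := decay _ F (fun a f => frame_phase_gap a f xC yC x1 y1)
  (kernel_frame_system x y) t st.
have eS : energy F s <= #|{: frame}|%:R * M ^+ 2.
  rewrite mulr_natl -sumr_const; apply: ler_sum => g _.
  rewrite cdot_normc lerXn2r ?nnegrE ?normc_ge0 ?(ltW M0) //.
  by apply: near => //; rewrite (ltW s0) lexx.
have {}eS : C * energy F s <= D by rewrite ler_pM2l.
move=> /le_trans/(_ eS) eD.
set u := expR _ * _; suff u2 : u ^+ 2 <= D.
  apply: le_trans (_ : D + 1 <= _); last first.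
    by rewrite lerDr mulr_ge0 ?expR_ge0 // ltW.
  have u0 : 0 <= (u - 1) ^+ 2 by exact: sqr_ge0.
  move: (u) u0 u2 => v; rewrite !expr2 => v0 v2; nra.
apply: le_trans eD; rewrite exprMn -cdot_normc expr2 -expRD.
apply: ler_pM; rewrite ?expR_ge0 ?cdot_ge0 //.
  by rewrite ler_expR; lra.
exact: (cdot_le_energy F t f).
Qed.

Lemma weyl_subconeZ (r : R) x : 0 < r ->
  weyl_subcone Pos lam delta x -> weyl_subcone Pos lam delta (r *: x).
Proof.
move=> r0 [[t t0 xE] xd]; split.
  exists (fun i => r * t i); first by move=> i; rewrite mulr_gt0.
  by rewrite xE scaler_sumr; apply: eq_bigr => i _; rewrite scalerA.
move=> a aPos; rewrite enormZ dotpZl (gtr0_norm r0) mulrCA ler_pM2l //.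
exact: xd.
Qed.

Lemma weightZ (r : R) x : 0 < r ->
  weight Pos k (r *: x) = expR (2 * gamma_k Pos k * ln r) * weight Pos k x.
Proof.
move=> r0; rewrite /gamma_k mulr_sumr mulr_suml expR_sum -big_split /=.
apply: eq_bigr => a _; rewrite dotpZr normrM powRM // (gtr0_norm r0).
by rewrite /powR gt_eqF.
Qed.

Lemma weight_gt0 x : x != 0 -> weyl_subcone Pos lam delta x -> 0 < weight Pos k x.
Proof.
move=> x0 [_ xd]; rewrite /weight big_seq; apply: prodr_gt0 => a aPos.
apply: powR_gt0; rewrite normr_gt0 dotpC gt_eqF //.
by apply: lt_le_trans (xd a aPos); rewrite mulr_gt0 // enorm_gt0.
Qed.

Let weight_size : R := \prod_(a <- Pos) ((\sum_j `|a 0 j|) `^ (2 * k a)).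

Lemma weight_le x : enorm x = 1 -> 0 <= weight Pos k x <= weight_size.
Proof.
move=> x1; apply/andP; split; first by apply: prodr_ge0 => a _; exact: powR_ge0.
rewrite /weight /weight_size big_seq [leRHS]big_seq; apply: ler_prod => a aPos.
rewrite powR_ge0 ge0_ler_powR ?nnegrE ?sumr_ge0 //.
  by rewrite mulr_ge0 //; case: mult_k => k0 _; rewrite k0 // (Pos_root posPos).
rewrite -[leRHS]mulr1; apply: norm_dotp_le => j; rewrite -x1.
exact: coord_le_enorm.
Qed.

(** Reduction to unit vectors with t = |x| |y|, and homogeneity of the
    weights. *)
Lemma kernel_weight_bound : Pos != fset0 -> exists2 c : R, 0 < c & forall x y,
  weyl_subcone Pos lam delta x -> weyl_subcone Pos lam delta y ->
  forall g, reflection_group Phi g ->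
  `|E ('i *: cvec x) (cvec (g y))| <=
    (c / Num.sqrt (weight Pos k x * weight Pos k y))%:C.
Proof.
move=> Pos0; have [c c0 decay] := kernel_decay.
have W0 : 0 <= weight_size by apply: prodr_ge0 => a _; exact: powR_ge0.
exists (c * (1 + weight_size)); first by rewrite mulr_gt0 // ltr_pwDl.
move=> x y xC yC g gG.
have x0 := weyl_subcone_neq0 rootPhi posPos dual Pos0 xC.
have y0 := weyl_subcone_neq0 rootPhi posPos dual Pos0 yC.
have [f freg fE] := reflection_group_frame rootPhi posPos simple dual delta gG.
have rx := enorm_gt0 x0; have ry := enorm_gt0 y0.
have wx := weight_gt0 x0 xC; have wy := weight_gt0 y0 yC.
pose x1 := (enorm x)^-1 *: x; pose y1 := (enorm y)^-1 *: y.
have xE : x = enorm x *: x1 by rewrite scalerA divff ?scale1r // gt_eqF.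
have yE : y = enorm y *: y1 by rewrite scalerA divff ?scale1r // gt_eqF.
have x1C : weyl_subcone Pos lam delta x1 by apply: weyl_subconeZ; rewrite ?invr_gt0.
have y1C : weyl_subcone Pos lam delta y1 by apply: weyl_subconeZ; rewrite ?invr_gt0.
have nx1 : enorm x1 = 1.
  by rewrite enormZ gtr0_norm ?invr_gt0 // mulVf // gt_eqF.
have ny1 : enorm y1 = 1.
  by rewrite enormZ gtr0_norm ?invr_gt0 // mulVf // gt_eqF.
have t0 : 0 < enorm x * enorm y by rewrite mulr_gt0.
have := decay x1 y1 (exist _ f freg) _ x1C y1C nx1 ny1 t0.
have -> : K ((enorm x * enorm y) *: x1) (place lam (val (exist _ f freg : frame)) y1) =
    E ('i *: cvec x) (cvec (g y)).
  rewrite (kernel_imaginary rootPhi posPos mult_k kernelE simple dual) -fE.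
  rewrite mulrC -scalerA -xE.
  rewrite (kernel_scale rootPhi posPos mult_k kernelE simple dual).
  by rewrite [in RHS]yE [in RHS]placeZ /kernel cvecZ scalerA mulrC.
move=> bnd; rewrite normrC lecR ler_pdivlMr ?sqrtr_gt0 ?mulr_gt0 //.
set e := expR _ in bnd; set N := normc _ in bnd *.
have e0 : 0 < e by exact: expR_gt0.
have wE : Num.sqrt (weight Pos k x * weight Pos k y) <= e * weight_size.
  rewrite -[leRHS]ger0_norm ?mulr_ge0 ?(ltW e0) // -sqrtr_sqr ler_sqrt ?sqr_ge0 //.
  rewrite [in weight _ _ x]xE [in weight _ _ y]yE (weightZ _ rx) (weightZ _ ry) exprMn.
  have -> : e ^+ 2 = expR (2 * gamma_k Pos k * ln (enorm x)) *
                    expR (2 * gamma_k Pos k * ln (enorm y)).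
    by rewrite /e expr2 -!expRD lnM ?posrE //; congr expR; ring.
  rewrite mulrACA ler_pM2l ?mulr_gt0 ?expR_gt0 // expr2.
  have /andP[? ?] := weight_le nx1; have /andP[? ?] := weight_le ny1.
  exact: ler_pM.
apply: le_trans (_ : N * (e * weight_size) <= _).
  by rewrite ler_wpM2l // normc_ge0.
rewrite mulrA [N * e]mulrC; apply: ler_pM => //.
- by rewrite mulr_ge0 ?(ltW e0) // normc_ge0.
- by rewrite lerDr.
Qed.

End Delta.

End UniformBound.

Theorem corollary2p7 (R : realType) (n : nat) (Phi Pos : {fset 'rV[R]_n})
    (al lam : 'I_n -> 'rV[R]_n) (k : 'rV[R]_n -> R)
    (E : 'rV[R[i]]_n -> 'rV[R[i]]_n -> R[i]) :
  reduced_root_system Phi ->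
  positive_subsystem Phi Pos ->
  simple_roots Pos al ->
  dual_basis al lam ->
  multiplicity_function Phi k ->
  0 < gamma_k Pos k ->
  is_dunkl_kernel Pos k E ->
  forall delta : R, 0 < delta ->
  exists2 c : R, 0 < c &
    forall x y : 'rV[R]_n,
      weyl_subcone Pos lam delta x -> weyl_subcone Pos lam delta y ->
    forall g : 'rV[R]_n -> 'rV[R]_n, reflection_group Phi g ->
      `|E ('i *: cvec x) (cvec (g y))| <=
        (c / Num.sqrt (weight Pos k x * weight Pos k y))%:C.
Proof.
move=> rootPhi posPos simple dual mult_k gk kernelE delta delta0.
apply: (kernel_weight_bound rootPhi posPos simple dual mult_k kernelE delta0).
by apply: contraTneq gk => ->; rewrite /gamma_k big_seq_fset0 ltxx.
Qed.
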